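(* Let $G_i$ be a free product of a finite set $S_i$ of finitely generated abelian groups for $i=1,2$. Then the following are equivalent: (1) The sets of ranks $\ge 2$ of groups in $S_1$ and $S_2$ are equal, i.e. $\{\operatorname{rank}(A) : A\in S_1,\ \operatorname{rank}(A)\ge 2\} = \{\operatorname{rank}(A) : A\in S_2,\ \operatorname{rank}(A)\ge 2\}$. (2) $G_1$ and $G_2$ are commensurable. (3) $G_1$ and $G_2$ are quasi-isometric.
   Context: The rank of a finitely generated abelian group is the rank of its free abelian part, i.e. the integer $n$ such that the group is isomorphic to $\mathbb{Z}^n\oplus T$ with $T$ finite. Two groups are commensurable if they have isomorphic finite-index subgroups (abstract commensurability). Finitely generated groups are quasi-isometric if they are quasi-isometric as metric spaces when equipped with word metrics coming from finite generating sets.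
   Formalization: Each free product is assumed to have at least two nontrivial factors and not to be Z/2*Z/2; without this the claim fails, e.g. S_1={Z^2}, S_2={Z^2,Z} have equal rank sets but Z^2 and Z^2*Z are not quasi-isometric. *)

(* Defs.v *)
From HB Require Import structures.
From mathcomp Require Import all_boot all_order all_algebra.
From mathcomp Require Import boolp classical_sets functions reals.

Set Implicit Arguments.
Unset Strict Implicit.
Unset Printing Implicit Defensive.

Import Order.TTheory GRing.Theory Num.Theory.
Import Algebra.

Local Open Scope classical_set_scope.
Local Open Scope ring_scope.

(* Abelian groups are written additively (zmodType); groups that need not be
   commutative are written multiplicatively (groupType, possibly infinite). *)

Definition fg_abelian (V : zmodType) : Prop :=
  exists s : seq V, forall x : V,
    exists c : 'I_(size s) -> int, x = \sum_(i < size s) s`_i *~ c i.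

Definition has_rank (V : zmodType) (n : nat) : Prop :=
  exists (T : finZmodType) (f : {additive V -> ('rV[int]_n * T)%type}),
    bijective f.

Definition ranks_ge2 (I : Type) (A : I -> zmodType) : set nat :=
  [set n | (2 <= n)%N /\ exists i, has_rank (A i) n].

(* G is the free product of the A i along the maps iota i: the universal
   property of the coproduct in the category of groups. *)
Definition is_free_product (I : Type) (A : I -> zmodType) (G : groupType)
    (iota : forall i, A i -> G) : Prop :=
  (forall i, {morph iota i : a b / (a + b)%R >-> (a * b)%g}) /\
  forall (H : groupType) (f : forall i, A i -> H),
    (forall i, {morph f i : a b / (a + b)%R >-> (a * b)%g}) ->
    exists! phi : G -> H,
      {morph phi : x y / (x * y)%g} /\ forall i a, phi (iota i a) = f i a.

Definition trivial_group (V : zmodType) : Prop := forall x : V, x = 0.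

Definition order_two (V : zmodType) : Prop :=
  exists2 x : V, x <> 0 & forall y : V, y = 0 \/ y = x.

(* At least two factors are nontrivial, and the free product is not
   Z/2 * Z/2. This excludes exactly the free products that are trivial, a
   single abelian group, or infinite dihedral. *)
Definition nonelementary (I : Type) (A : I -> zmodType) : Prop :=
  (exists i j : I,
     [/\ i <> j, ~ trivial_group (A i) & ~ trivial_group (A j)]) /\
  ~ (exists i j : I,
       [/\ i <> j, order_two (A i), order_two (A j) &
           forall k : I, k <> i -> k <> j -> trivial_group (A k)]).

Definition is_subgroup (G : groupType) (H : set G) : Prop :=
  [/\ H 1%g, forall x y, H x -> H y -> H (x * y)%g &
      forall x, H x -> H (x^-1)%g].

Definition finite_index (G : groupType) (H : set G) : Prop :=
  exists s : seq G, forall g : G, exists2 x, x \in s & H (x^-1 * g)%g.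

Definition commensurable (G1 G2 : groupType) : Prop :=
  exists (H1 : set G1) (H2 : set G2),
    [/\ is_subgroup H1 /\ finite_index H1,
        is_subgroup H2 /\ finite_index H2 &
        exists2 f : G1 -> G2, set_bij H1 H2 f &
          forall x y, H1 x -> H1 y -> f (x * y)%g = (f x * f y)%g].

Section WordMetric.
Variables (G : groupType) (X : seq G).

Definition is_word (w : seq G) (g : G) : Prop :=
  {in w, forall x, x \in X \/ (x^-1)%g \in X} /\ (\prod_(x <- w) x)%g = g.

Definition generates : Prop := forall g : G, exists w, is_word w g.

(* The junk value 0 is only used for elements outside the subgroup generated
   by X. *)
Definition word_length (g : G) : nat :=
  xget 0%N [set n | (exists2 w, is_word w g & size w = n) /\
                    forall w, is_word w g -> (n <= size w)%N].

End WordMetric.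

Definition word_dist (R : realType) (G : groupType) (X : seq G) (x y : G) : R :=
  (word_length X (x^-1 * y)%g)%:R.

Definition quasi_isometric_spaces (R : realType) (M N : Type)
    (dM : M -> M -> R) (dN : N -> N -> R) : Prop :=
  exists (f : M -> N) (K C : R),
    [/\ 1 <= K, 0 <= C,
        forall x y, K^-1 * dM x y - C <= dN (f x) (f y) <= K * dM x y + C &
        forall z, exists x, dN (f x) z <= C].

Definition quasi_isometric (R : realType) (G1 G2 : groupType) : Prop :=
  exists (X1 : seq G1) (X2 : seq G2),
    [/\ generates X1, generates X2 &
        quasi_isometric_spaces (word_dist R X1) (word_dist R X2)].

(* Main.v *)
Require Import Defs.
From HB Require Import structures.
From mathcomp Require Import all_boot all_order all_algebra.
From mathcomp Require Import boolp classical_sets functions reals.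
From mathcomp Require Import zify.

Set Implicit Arguments.
Unset Strict Implicit.
Unset Printing Implicit Defensive.

Import Order.TTheory GRing.Theory Num.Theory.
Import Algebra.

Local Open Scope classical_set_scope.
Local Open Scope ring_scope.

(** Every free product is compared with a concrete one, [freeprod A], whose
    elements are the reduced words in the factors ([free_normal_form]).

    Equal ranks imply commensurable.  If a free product [G] acts transitively on
    a finite set [X], the stabilizer of a point is a free product of stabilizers
    in the factors, one for each orbit of each factor, and of infinite cyclic
    groups ([kurosh]).  Instead of covering spaces, the proof uses an action of
    [G] on [X * P], where [P] is the expected stabilizer: it is an action on [X]
    together with a cocycle with values in [P], it is defined factor by factor,
    and [X * P -> G] turns out to be an equivariant bijection
    ([commensurable_stabilizer]).
    With [X] the product of the torsion subgroups of all factors, [G] is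
    commensurable with a free product of lattices [Z^n], at least two of them
    nontrivial and with the same ranks [>= 2] ([torsion_free_cover]).  From then
    on only the list of ranks matters.  In a cover of degree [d] the number of
    nontrivial factors minus one is multiplied by [d], and for each factor one
    chooses whether it is kept once or repeated [d] times, one of them at least
    being kept; copies of [Z] make up the difference ([cyclic_cover]).  So a
    double cover adds one more copy of any given factor, at the price of some
    copies of [Z].  This makes the multiplicities of all ranks [>= 2] agree; the
    two lists then have [p + 1] and [q + 1] entries, and covers of degrees [q]
    and [p] make the copies of [Z] agree as well ([lattice_prod_same_ranks]).

    Commensurable implies quasi-isometric.  An isomorphism of finite-index
    subgroups, precomposed with a choice of a close point of the subgroup, sends
    neighbours into a finite set of differences, as in Schreier's lemma
    ([coset_map_lipschitz]); the same holds in the other direction, and the two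
    maps are inverse up to a bounded error.

    Quasi-isometric implies equal ranks.  A quasi-isometry and its quasi-inverse
    map finite sets of differences into finite sets of differences
    ([coarse_pair]), and this is all that is used.  Let [Z^n] with [n >= 2] lie in
    a factor of [G1].  It is one-ended ([complement_connected]), while each point
    of each coset [g A_i] separates [G2]: a path can change its projection to
    [g A_i] only inside [g A_i] ([fp_exit]).  Hence the image of [Z^n] stays close
    to a single coset [g A_j] ([lattice_near_coset]), and comparing the growth of
    [Z^n] and of [A_j] gives [n <= m], where [m] is the rank of [A_j]
    ([lattice_near_rank]).  The quasi-inverse takes [g A_j] back to a coset of
    some factor of [G1], which contains the original [Z^n] up to bounded error;
    a retraction shows that it is a coset of the factor one started from
    ([lattice_same_factor]), so that [m <= n].

    That a finitely generated abelian group has a rank at all is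
    [fg_abelian_rank]; its rank is unique by growth ([rank_unique]). *)

(** * Homomorphisms *)

Lemma ghom1 (G H : groupType) (f : G -> H) :
  {morph f : x y / (x * y)%g} -> f 1%g = 1%g.
Proof. by move=> fM; apply: (@mulgI _ (f 1%g)); rewrite -fM !mulg1. Qed.

Lemma ghomV (G H : groupType) (f : G -> H) :
  {morph f : x y / (x * y)%g} -> {morph f : x / (x^-1)%g}.
Proof.
by move=> fM x; apply/esym/mulg1_eq; rewrite -fM mulgV ghom1.
Qed.

Section AdditiveToGroup.
Variables (V : zmodType) (H : groupType) (f : V -> H).
Hypothesis fD : {morph f : a b / (a + b)%R >-> (a * b)%g}.

Lemma zhom0 : f 0 = 1%g.
Proof. by apply: (@mulgI _ (f 0)); rewrite -fD mulg1 addr0. Qed.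

Lemma zhomN a : f (- a) = (f a)^-1%g.
Proof. by apply/esym/mulg1_eq; rewrite -fD subrr zhom0. Qed.

End AdditiveToGroup.

(** * Reduced words and the concrete free product *)

Section FreeProduct.
Variables (I : finType) (A : I -> zmodType).

Definition syllable := {i : I & A i}.
Implicit Types (s t : seq syllable) (i j : I).

Definition syl i (a : A i) : syllable := Tagged A a.

Definition reduced s :=
  all (fun x : syllable => tagged x != 0) s &&
  sorted (fun x y : syllable => tag x != tag y) s.

(** The first syllable of a word if it lies in the factor [i], and 0
    otherwise.  Geometrically, this is the nearest-point projection of the free
    product onto its factor [A i] ([fp_exit]). *)
Definition head_syl i s : A i := if s is x :: _ then untag 0 (@id (A i)) x else 0.

Definition tail_syl i s := if s is x :: t then if tag x == i then t else s else [::].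

Definition cons_syl i (a : A i) s := if a == 0 then s else syl a :: s.

(** Left multiplication by an element of the factor [A i].  Splitting a word
    into its [i]-head and the rest, which avoids [i], reduces the case analysis
    on cancellation to the addition of [A i]. *)
Definition act i (a : A i) s := cons_syl (a + head_syl i s) (tail_syl i s).

Definition avoids i s := if s is x :: _ then tag x != i else true.

Lemma head_syl_cons i (a : A i) s : head_syl i (syl a :: s) = a.
Proof. by rewrite /head_syl /= (untagE _ _ (erefl : tag (syl a) = i)). Qed.

Lemma head_syl_avoids i s : avoids i s -> head_syl i s = 0.
Proof. by case: s => //= x s; apply: untag_dflt. Qed.

Lemma tail_syl_avoids i s : avoids i s -> tail_syl i s = s.
Proof. by case: s => //= x s /negPf ->. Qed.

Lemma reduced_cons i (a : A i) s :
  reduced (syl a :: s) = [&& a != 0, avoids i s & reduced s].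
Proof.
rewrite /reduced /=; case: s => [|x s] /=; first by rewrite !andbT.
by rewrite [i == _]eq_sym; case: (a != 0) (_ == i) (tagged x != 0)=> [] [] [] //=;
   rewrite ?andbF.
Qed.

Lemma reduced_cons_syl i (a : A i) s : avoids i s -> reduced s -> reduced (cons_syl a s).
Proof.
rewrite /cons_syl; case: ifP => // a0 iNs rs.
by rewrite reduced_cons a0 iNs.
Qed.

Lemma head_syl_cons_syl i (a : A i) s : avoids i s -> head_syl i (cons_syl a s) = a.
Proof.
rewrite /cons_syl; case: eqP => [-> /head_syl_avoids //|_ _].
exact: head_syl_cons.
Qed.

Lemma tail_syl_cons_syl i (a : A i) s : avoids i s -> tail_syl i (cons_syl a s) = s.
Proof. by rewrite /cons_syl; case: eqP => [_ /tail_syl_avoids //|_ _ /=]; rewrite eqxx. Qed.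

Lemma reduced_tail_syl i s : reduced s -> avoids i (tail_syl i s) && reduced (tail_syl i s).
Proof.
case: s => [|[j b] s] //=; rewrite -/(syl b) reduced_cons => /and3P[b0 jNs rs].
case: ifPn => [/eqP <-|ji]; first by rewrite jNs.
by rewrite /= ji reduced_cons b0 jNs.
Qed.

Lemma avoids_tail_syl i s : reduced s -> avoids i (tail_syl i s).
Proof. by case/(reduced_tail_syl i)/andP. Qed.

Lemma cons_head_tail i s : reduced s -> cons_syl (head_syl i s) (tail_syl i s) = s.
Proof.
case: s => [|[j b] s]; first by rewrite /cons_syl eqxx.
rewrite -/(syl b) reduced_cons => /and3P[b0 jNs rs]; rewrite /=.
case: eqP => [e|/eqP ne]; last by rewrite (untag_dflt) // /cons_syl eqxx.
by subst j; rewrite (untagE _ _ (erefl : tag (syl b) = i)) /= /cons_syl (negPf b0).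
Qed.

Lemma reduced_act i (a : A i) s : reduced s -> reduced (act a s).
Proof. by case/(reduced_tail_syl i)/andP; apply: reduced_cons_syl. Qed.

Lemma reduced_behead x s : reduced (x :: s) -> reduced s.
Proof. by case: x => i a; rewrite -/(syl a) reduced_cons => /and3P[]. Qed.

Lemma act_cons x s : reduced (x :: s) -> act (tagged x) s = x :: s.
Proof.
case: x => i a; rewrite -/(syl a) reduced_cons => /and3P[a0 iNs _].
by rewrite /act /= head_syl_avoids // tail_syl_avoids // addr0 /cons_syl (negPf a0).
Qed.

Definition freeprod := {s : seq syllable | reduced s}.
HB.instance Definition _ := Choice.on freeprod.
HB.instance Definition _ := SubType.on freeprod.

Section WordAction.
Variables (Z : Type) (al : forall i, A i -> Z -> Z).

Definition word_act s (z : Z) := foldr (fun x : syllable => al (tagged x)) z s.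

Hypothesis al0 : forall i z, @al i 0 z = z.
Hypothesis alD : forall i a b z, @al i (a + b) z = al a (al b z).

Lemma word_act_cat s t z : word_act (s ++ t) z = word_act s (word_act t z).
Proof. by rewrite /word_act foldr_cat. Qed.

Lemma word_act_cons_syl i (a : A i) s z : word_act (cons_syl a s) z = al a (word_act s z).
Proof. by rewrite /cons_syl; case: eqP => [->|//]; rewrite al0. Qed.

Lemma word_act_act i (a : A i) s z : reduced s -> word_act (act a s) z = al a (word_act s z).
Proof.
by move=> rs; rewrite /act word_act_cons_syl alD -word_act_cons_syl cons_head_tail.
Qed.

Definition negword s := rev [seq syl (- tagged x) | x : syllable <- s].

Lemma word_act_negword s z : word_act (negword s) (word_act s z) = z.
Proof.
elim: s => //= x s IH; rewrite /negword /= rev_cons -cats1 word_act_cat /=.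
by rewrite -alD addNr al0 IH.
Qed.

Lemma word_act_negwordr s z : word_act s (word_act (negword s) z) = z.
Proof.
elim: s z => //= x s IH z; rewrite /negword /= rev_cons -cats1 word_act_cat /=.
by rewrite IH -alD subrr al0.
Qed.

End WordAction.

Definition factor_act i (a : A i) (w : freeprod) : freeprod :=
  exist (fun s => is_true (reduced s)) (act a (val w)) (reduced_act a (valP w)).

Lemma factor_act0 i w : factor_act (0 : A i) w = w.
Proof. by apply: val_inj; rewrite /= /act add0r cons_head_tail // (valP w). Qed.

Lemma factor_actD i (a b : A i) w : factor_act (a + b) w = factor_act a (factor_act b w).
Proof.
apply: val_inj => /=; have /avoids_tail_syl h := valP w.
by rewrite /act head_syl_cons_syl // tail_syl_cons_syl // addrA.
Qed.

Definition fp1 : freeprod := exist (fun s => is_true (reduced s)) [::] erefl.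
Definition fpmul (u v : freeprod) := word_act factor_act (val u) v.
Definition fpinv (u : freeprod) := word_act factor_act (negword (val u)) fp1.

Section ReducedWordAction.
Variables (Z : Type) (al : forall i, A i -> Z -> Z).
Hypothesis al0 : forall i z, @al i 0 z = z.
Hypothesis alD : forall i a b z, @al i (a + b) z = al a (al b z).

(** When [Z] is the set of reduced words itself this is associativity of the
    product; for other [Z], the multiplicativity of homomorphisms and cocycles
    defined on the factors. *)
Lemma word_act_ext s (v : freeprod) z :
  word_act al (val (word_act factor_act s v)) z = word_act al s (word_act al (val v) z).
Proof.
by elim: s => //= x s IH; rewrite word_act_act ?IH //; apply: valP.
Qed.

End ReducedWordAction.

Lemma fpmulA : associative fpmul.
Proof. by move=> u v w; rewrite /fpmul word_act_ext //; [apply: factor_act0|apply: factor_actD]. Qed.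

Lemma fpmul1 : right_id fp1 fpmul.
Proof.
move=> [s rs]; rewrite /fpmul /=; apply: val_inj => /=.
elim: s rs => //= x s IH rs; rewrite IH ?act_cons //.
exact: reduced_behead rs.
Qed.

Lemma fp1mul : left_id fp1 fpmul. Proof. by []. Qed.

Lemma fpmulV : left_inverse fp1 fpinv fpmul.
Proof.
move=> u; rewrite /fpmul /fpinv word_act_ext /=; [|exact: factor_act0|exact: factor_actD].
rewrite -[X in word_act _ _ X](fpmul1 u).
by rewrite word_act_negword; [|exact: factor_act0|exact: factor_actD].
Qed.

Lemma fpmulVr : right_inverse fp1 fpinv fpmul.
Proof.
move=> u; rewrite /fpmul /fpinv.
by rewrite word_act_negwordr; [|exact: factor_act0|exact: factor_actD].
Qed.

HB.instance Definition _ :=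
  isGroup.Build freeprod fpmulA fp1mul fpmul1 fpmulV fpmulVr.

Definition finj i (a : A i) : freeprod := factor_act a fp1.

Lemma val_finj i (a : A i) : val (finj a) = cons_syl a [::].
Proof. by rewrite /= /act /= addr0. Qed.

Lemma val_mulg (u v : freeprod) : val (u * v)%g = val (word_act factor_act (val u) v).
Proof. by []. Qed.

Lemma finj_mul i (a : A i) (w : freeprod) : (finj a * w)%g = factor_act a w.
Proof.
apply: val_inj; rewrite val_mulg val_finj /cons_syl.
by case: eqP => //= ->; rewrite -[in LHS](factor_act0 i w).
Qed.

Lemma finjD i : {morph @finj i : a b / (a + b)%R >-> (a * b)%g}.
Proof. by move=> a b; rewrite finj_mul /finj factor_actD. Qed.

Definition fsyl (x : syllable) := finj (tagged x).

Lemma freeprod_word (w : freeprod) : w = (\prod_(x <- val w) fsyl x)%g.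
Proof.
rewrite -{1}[w]mulg1 -[LHS]/(word_act factor_act (val w) 1%g).
elim: (val w) => [|x s IH]; first by rewrite big_nil.
by rewrite big_cons [LHS]/= IH -finj_mul.
Qed.

(** A free product acts as soon as its factors do; this is how homomorphisms
    out of [freeprod A], and cocycles on it, are produced. *)
Section FreeProductAction.
Variables (Z : Type) (al : forall i, A i -> Z -> Z).
Hypothesis al0 : forall i z, @al i 0 z = z.
Hypothesis alD : forall i a b z, @al i (a + b) z = al a (al b z).

Definition fp_act (w : freeprod) (z : Z) := word_act al (val w) z.

Lemma fp_actM u v z : fp_act (u * v)%g z = fp_act u (fp_act v z).
Proof. exact: word_act_ext. Qed.

Lemma fp_act_inj i (a : A i) z : fp_act (finj a) z = al a z.
Proof.
rewrite /fp_act val_finj /cons_syl; case: eqP => //= ->.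
by rewrite al0.
Qed.

End FreeProductAction.

Lemma freeprod_free : is_free_product finj.
Proof.
split=> [i|H f fD]; first exact: finjD.
have al0 i z : (f i 0 * z)%g = z by rewrite (zhom0 (fD i)) mul1g.
have alD i a b z : (f i (a + b)%R * z = f i a * (f i b * z))%g.
  by rewrite fD mulgA.
pose phi w := fp_act (fun i a z => (f i a * z)%g) w 1%g.
have phiE w z : (fp_act (fun i a z => (f i a * z)%g) w z = phi w * z)%g.
  rewrite /phi /fp_act; elim: (val w) => [|x s IH] /=; first by rewrite mul1g.
  by rewrite IH mulgA.
exists phi; split=> [|psi [psiM psiE]].
  split=> [u v|i a]; first by rewrite {1}/phi fp_actM.
  by rewrite /phi fp_act_inj // mulg1.
apply/funext => w; rewrite [in RHS](freeprod_word w) /phi /fp_act.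
elim: (val w) => [|x s IH] /=; first by rewrite big_nil ghom1.
by rewrite big_cons psiM psiE IH.
Qed.

End FreeProduct.

Definition gisom (G H : groupType) (f : G -> H) (g : H -> G) :=
  [/\ {morph f : x y / (x * y)%g}, {morph g : x y / (x * y)%g},
      cancel f g & cancel g f].

Section FreeProductUniq.
Variables (I : finType) (A : I -> zmodType) (G : groupType).
Variable (iota : forall i, A i -> G).
Hypothesis hG : is_free_product iota.

Lemma free_homE (H : groupType) (f : forall i, A i -> H) :
    (forall i, {morph f i : a b / (a + b)%R >-> (a * b)%g}) ->
  exists2 phi : G -> H, {morph phi : x y / (x * y)%g} &
    forall i a, phi (iota a) = f i a.
Proof. by move=> /(proj2 hG H) [phi [[pM pE] _]]; exists phi. Qed.

Lemma free_hom_eq (H : groupType) (phi psi : G -> H) :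
    {morph phi : x y / (x * y)%g} -> {morph psi : x y / (x * y)%g} ->
    (forall i (a : A i), phi (iota a) = psi (iota a)) -> phi =1 psi.
Proof.
move=> phiM psiM E x.
have fD i : {morph (fun a : A i => psi (iota a)) : a b / (a + b)%R >-> (a * b)%g}.
  by move=> a b /=; rewrite (proj1 hG) psiM.
have [th [_ U]] := proj2 hG H (fun i a => psi (iota a)) fD.
by rewrite -(U phi) // -(U psi).
Qed.

End FreeProductUniq.

Lemma free_isom (I J : finType) (A : I -> zmodType) (B : J -> zmodType)
    (G H : groupType) (iota : forall i, A i -> G) (kappa : forall j, B j -> H)
    (hG : is_free_product iota) (hH : is_free_product kappa)
    (f : G -> H) (g : H -> G) :
    {morph f : x y / (x * y)%g} -> {morph g : x y / (x * y)%g} ->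
    (forall i (a : A i), g (f (iota i a)) = iota i a) ->
    (forall j (b : B j), f (g (kappa j b)) = kappa j b) ->
  gisom f g.
Proof.
move=> fM gM E1 E2; split=> //.
  by apply: (free_hom_eq hG) => // x y; rewrite /= ?fM ?gM.
by apply: (free_hom_eq hH) => // x y; rewrite /= ?gM ?fM.
Qed.

Lemma free_normal_form (I : finType) (A : I -> zmodType) (G : groupType)
    (iota : forall i, A i -> G) (hG : is_free_product iota) :
  exists (f : G -> freeprod A) (g : freeprod A -> G),
    [/\ gisom f g, forall i a, f (iota i a) = finj a &
        forall i (a : A i), g (finj a) = iota i a].
Proof.
have [f fM fE] := free_homE hG (@finjD _ A).
have [g gM gE] := free_homE (freeprod_free A) (proj1 hG).
exists f, g; split=> //.
by apply: (free_isom hG (freeprod_free A)) => // i a; rewrite ?fE ?gE ?fE.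
Qed.

(** * Structure of finitely generated abelian groups *)

HB.instance Definition _ (S T : finZmodType) := GRing.Zmodule.on (S * T)%type.

Section FinGenAbelian.
Variable V : zmodType.

Definition comb k (u : 'I_k -> V) (c : 'I_k -> int) := \sum_i u i *~ c i.

Definition span1 k (t : V) (u : 'I_k -> V) (x : V) :=
  exists m c, x = t *~ m + comb u c.

Lemma combD k (u : 'I_k -> V) c c' :
  comb u (fun i => c i + c' i) = comb u c + comb u c'.
Proof. by rewrite /comb -big_split; apply: eq_bigr => i _; rewrite mulrzDr. Qed.

Lemma combN k (u : 'I_k -> V) c : comb u (fun i => - c i) = - comb u c.
Proof. by rewrite /comb -sumrN; apply: eq_bigr => i _; rewrite mulrNz. Qed.

Lemma combZ k (u : 'I_k -> V) c m : comb u (fun i => c i * m) = comb u c *~ m.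
Proof. by rewrite /comb mulrz_suml; apply: eq_bigr => i _; rewrite mulrzA. Qed.

Lemma comb_lift k (u : 'I_k.+1 -> V) i c :
  comb u c = u i *~ c i + comb (u \o lift i) (c \o lift i).
Proof. by rewrite /comb (bigD1_ord i). Qed.

(** A step of the Euclidean algorithm: in a relation, the coefficient of [u_j] is
    reduced by [q] times that of [t], and [u_j] becomes the leading generator. *)
Lemma span1_swap k (t : V) (u : 'I_k -> V) j q x :
  span1 t u x <->
  span1 (u j) (fun l => if l == j then t + u j *~ q else u l) x.
Proof.
set u' := fun l => _.
have E c : comb u' c = (t + u j *~ q) *~ c j + \sum_(l | l != j) u l *~ c l.
  rewrite /comb (bigD1 j) //= /u' eqxx; congr (_ + _).
  by apply: eq_bigr => l /negPf ->.
split=> [] [m [c ->]].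
  exists (c j - q * m), (fun l => if l == j then m else c l).
  rewrite E eqxx /comb (bigD1 j) //=.
  rewrite [\sum_(l | _) u l *~ (if _ then _ else _)](eq_bigr (fun l => u l *~ c l));
    last by move=> l /negPf ->.
  rewrite mulrzDl -mulrzA mulrzBr !addrA; congr (_ + _).
  by rewrite [RHS]addrAC subrK addrC.
exists (c j), (fun l => if l == j then m + q * c j else c l).
rewrite E /comb [in RHS](bigD1 j) //= eqxx.
rewrite [\sum_(l | _) u l *~ (if _ then _ else _)](eq_bigr (fun l => u l *~ c l));
  last by move=> l /negPf ->.
by rewrite mulrzDl -mulrzA mulrzDr !addrA; do 2!congr (_ + _);
  rewrite addrC.
Qed.

(** The conclusion of the structure theorem, for the subgroup generated by [s];
    stated inside [V] so that an induction needs no quotients or subtypes. *)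
Definition split_by k (s : 'I_k -> V) :=
  exists (n : nat) (T : finZmodType) (e : {additive ('rV[int]_n * T)%type -> V}),
    injective e /\ forall x, (exists c, x = comb s c) <-> exists z, x = e z.

Lemma split_by_free k (s : 'I_k -> V) :
  (forall c, comb s c = 0 -> forall i, c i = 0) -> split_by s.
Proof.
move=> sfree; pose e (z : 'rV[int]_k * 'I_1) := comb s (fun i => z.1 0 i).
have eB : zmod_morphism e.
  move=> x y; rewrite /e -combN -combD; apply: eq_bigr => i _ /=.
  by rewrite !mxE.
pose eA := GRing.isZmodMorphism.Build _ _ e eB.
pose e' : {additive _ -> _} := HB.pack e eA.
exists k, 'I_1, e'; split.
  apply: raddf_inj => -[z o] /= /sfree z0; rewrite [o]ord1; congr pair.
  by apply/rowP => i; rewrite z0 mxE.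
move=> x; split=> [[c ->]|[z ->]]; last by exists (fun i => z.1 0 i).
exists (\row_i c i, 0) => /=; apply: eq_bigr => i _ /=.
by rewrite mxE.
Qed.

(** The minimality of [d] makes the span of [t] and of [u] a direct sum, so a
    decomposition of the latter extends by [Z/d]. *)
Lemma split_by_cyclic k (t : V) (u : 'I_k -> V) (d : nat) (s : 'I_k.+1 -> V) :
    (0 < d)%N -> t *+ d = 0 ->
    (forall (m : nat) c, t *+ m + comb u c = 0 -> (d %| m)%N) ->
    (forall x, (exists c, x = comb s c) <-> span1 t u x) ->
  split_by u -> split_by s.
Proof.
case: d => // d _ td dmin sE [n [T [e [einj eE]]]].
have tmod m : t *+ (m %% d.+1) = t *+ m.
  by rewrite [in RHS](divn_eq m d.+1) mulrnDr mulnC mulrnA td mul0rn add0r.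
pose e1 (z : 'rV[int]_n * ('I_d.+1 * T)) := t *+ (z.2.1 : nat) + e (z.1, z.2.2).
have e1D : {morph e1 : x y / x + y}.
  move=> [x [a b]] [x' [a' b']]; rewrite /e1 /= tmod mulrnDr.
  rewrite addrACA; congr (_ + _).
  exact: (raddfD e (x, b) (x', b')).
have e10 : e1 0 = 0 by apply: (@addrI _ (e1 0)); rewrite -e1D !addr0.
have e1B : zmod_morphism e1.
  by move=> x y; apply/(canRL (addrK _)); rewrite -e1D subrK.
pose eA := GRing.isZmodMorphism.Build _ _ e1 e1B.
pose e' : {additive _ -> _} := HB.pack e1 eA.
exists n, ('I_d.+1 * T)%type, e'; split.
  apply: raddf_inj => -[x [a b]] /= E.
  have /eE [c Ec] : exists z, e (x, b) = e z by exists (x, b).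
  have a0 : a = 0.
    apply/val_inj => /=; move: E; rewrite /e1 /= Ec => /dmin.
    case: (val a) (ltn_ord a) => // m h head_syl.
    by have := dvdn_leq (ltn0Sn m) head_syl; lia.
  move: E; rewrite /e1 /= a0 /= mulr0n add0r => E.
  by have [-> ->] : (x, b) = 0 by apply: einj; rewrite raddf0.
move=> x; split.
  case/sE => [m [c ->]].
  have /eE [[y b] Eb] : exists c', comb u c = comb u c' by exists c.
  have d0 : d.+1%:Z != 0 by [].
  have mlt : (`|(m %% d.+1)%Z|%N < d.+1)%N.
    by rewrite -ltz_nat gez0_abs ?modz_ge0 // ltz_pmod.
  exists (y, (Ordinal mlt, b)); rewrite /= /e1 /= -Eb; congr (_ + _).
  rewrite [in LHS](divz_eq m d.+1) mulrzDr mulrC mulrzA -pmulrn td mul0rz add0r.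
  by rewrite -[in LHS](gez0_abs (modz_ge0 m d0)) -pmulrn.
case=> [[y [a b]] ->]; apply/sE => /=.
have /eE [c Ec] : exists z, e (y, b) = e z by exists (y, b).
by exists (a : nat), c; rewrite /e1 /= Ec -pmulrn.
Qed.

(** Among all relations on all generating families of the same size as [s],
    one whose leading coefficient [d] is positive and minimal has all its
    coefficients divisible by [d]: it then splits off a cyclic summand of
    order [d]. *)
Lemma split_by_all k (s : 'I_k -> V) : split_by s.
Proof.
elim: k s => [|k IH] s; first by apply: split_by_free => c _ [].
case: (pselect (forall c, comb s c = 0 -> forall i, c i = 0)) => [|nfree].
  exact: split_by_free.
pose W x := exists c, x = comb s c.
pose rel d := `[< (0 < d)%N /\ exists t (u : 'I_k -> V) c,
  (forall x, W x <-> span1 t u x) /\ t *+ d + comb u c = 0 >].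
have ex : exists d, rel d.
  have [c [i [c0 ci]]] : exists c i, comb s c = 0 /\ c i > 0.
    have [c [c0 [i ci]]] : exists c, comb s c = 0 /\ exists i, c i != 0.
      apply: contrapT => h; apply: nfree => c c0 i; apply: contrapT => ci.
      by apply: h; exists c; split=> //; exists i; apply/eqP.
    case: (ltrgtP (c i) 0) ci => // ci _; last by exists c, i.
    by exists (fun i => - c i), i; rewrite combN c0 oppr0 oppr_gt0.
  exists `|c i|%N; apply/asboolP; split; first by rewrite absz_gt0 gt_eqF.
  exists (s i), (s \o lift i), (c \o lift i); split; last first.
    by rewrite -c0 (comb_lift _ i) pmulrn gez0_abs // ltW.
  move=> x; split=> [[c' ->]|[m [c' ->]]].
    by exists (c' i), (c' \o lift i); rewrite (comb_lift _ i).
  exists (fun j => if unlift i j is Some l then c' l else m).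
  rewrite (comb_lift _ i) /= unlift_none; congr (_ + _).
  by apply: eq_bigr => l _ /=; rewrite liftK.
have [d /asboolP[d0 [t [u [c [WE Ec]]]]] dmin] := ex_minnP ex.
have dZ0 : d%:Z != 0 by rewrite gt_eqF // ltz_nat.
(* otherwise a Euclidean division would give a smaller d *)
have dvd j : (d %| c j)%Z.
  apply/dvdz_mod0P/eqP; apply: contraT => r0; set r := (c j %% d)%Z in r0 *.
  have rge : 0 <= r by rewrite modz_ge0.
  have rlt : (`|r| < d)%N by rewrite -ltz_nat gez0_abs // ltz_pmod.
  suff /dmin : rel `|r|%N by rewrite leqNgt rlt.
  apply/asboolP; split; first by rewrite absz_gt0.
  exists (u j), (fun l => if l == j then t + u j *~ (c j %/ d)%Z else u l),
    (fun l => if l == j then d%:Z else c l).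
  split; first by move=> x; rewrite WE; apply: span1_swap.
  rewrite pmulrn gez0_abs // -[RHS]Ec /comb [in RHS](bigD1 j) //=
    [in LHS](bigD1 j) //= !eqxx.
  rewrite [in LHS](eq_bigr (fun l => u l *~ c l)); last by move=> l /negPf ->.
  rewrite addrA [t *+ d + _]addrA; congr (_ + _).
  rewrite mulrzDl addrCA -pmulrn -mulrzA; congr (_ + _).
  by rewrite -mulrzDr addrC /r -divz_eq.
(* dividing the relation by d gives an element killed by d *)
pose t' := t + comb u (fun j => (c j %/ d)%Z).
have t'd : t' *+ d = 0.
  rewrite -[RHS]Ec pmulrn mulrzDl -pmulrn -combZ; congr (_ + _).
  by apply: eq_bigr => j _; rewrite divzK.
have WE' x : W x <-> span1 t' u x.
  rewrite WE; split=> [] [m [c' ->]].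
    exists m, (fun j => c' j - (c j %/ d)%Z * m).
    by rewrite combD combN combZ mulrzDl addrACA subrr addr0.
  exists m, (fun j => c' j + (c j %/ d)%Z * m).
  by rewrite combD combZ mulrzDl -addrA [comb u c' + _]addrC.
apply: (split_by_cyclic d0 t'd _ WE' (IH u)) => m c' E.
rewrite /dvdn; apply: contraT; rewrite -lt0n => r0.
suff /dmin : rel (m %% d)%N by rewrite leqNgt ltn_mod d0.
apply/asboolP; split=> //; exists t', u, c'; split=> //.
rewrite -[RHS]E [in RHS](divn_eq m d) mulrnDr mulnC [t' *+ (d * _)]mulrnA t'd.
by rewrite mul0rn add0r.
Qed.

End FinGenAbelian.

Lemma fg_abelian_rank (V : zmodType) : fg_abelian V -> exists n, has_rank V n.
Proof.
case=> s sV; have [n [T [e [einj eE]]]] := split_by_all (fun i : 'I_(size s) => s`_i).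
have esurj x : exists z, e z = x.
  have [c Ec] := sV x.
  have /eE [z ->] : exists c, x = comb (fun i : 'I_(size s) => s`_i) c by exists c.
  by exists z.
have [f fE] := choice esurj.
have fB : zmod_morphism f.
  by move=> x y; apply: einj; rewrite raddfB !fE.
pose fA := GRing.isZmodMorphism.Build _ _ f fB.
pose f' : {additive _ -> _} := HB.pack f fA.
exists n, T, f'; exists e => // z; apply: einj; exact: fE.
Qed.

(** * Commensurability *)

Definition fi_subgroup (G : groupType) (H : set G) :=
  is_subgroup H /\ finite_index H.

(** The inverse is part of the data, which makes the relation visibly symmetric;
    [f] and [g] are total functions because subgroups are sets of elements. *)
Definition partial_isom (G1 G2 : groupType) (H1 : set G1) (H2 : set G2)
    (f : G1 -> G2) (g : G2 -> G1) :=
  [/\ forall x, H1 x -> H2 (f x) /\ g (f x) = x,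
      forall y, H2 y -> H1 (g y) /\ f (g y) = y &
      forall x y, H1 x -> H1 y -> f (x * y)%g = (f x * f y)%g].

Lemma commensurableP (G1 G2 : groupType) :
  commensurable G1 G2 <->
  exists H1 H2 f g, [/\ fi_subgroup H1, fi_subgroup H2 &
                        @partial_isom G1 G2 H1 H2 f g].
Proof.
split=> [[H1 [H2 [h1 h2 [f [fF fI fS] fM]]]]|[H1 [H2 [f [g [h1 h2 [fE gE fM]]]]]]].
  have ex y : exists x, H2 y -> H1 x /\ f x = y.
    case: (pselect (H2 y)) => [/fS[x xH <-]|nH]; first by exists x.
    by exists 1%g => /nH.
  have [g gE] := choice ex.
  exists H1, H2, f, g; split=> //; split=> // x xH.
  have fxH : H2 (f x) by apply: fF.
  split=> //; have [gH e] := gE _ fxH.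
  by apply: fI => //; rewrite inE.
exists H1, H2; split=> //; exists f => //; split.
- by move=> x /fE[].
- by move=> x y; rewrite !inE => /fE[_ {2}<-] /fE[_ {2}<-] ->.
- by move=> y /gE[xH <-]; exists (g y).
Qed.

Lemma partial_isom_sym (G1 G2 : groupType) (H1 : set G1) (H2 : set G2) f g :
  is_subgroup H1 -> partial_isom H1 H2 f g -> partial_isom H2 H1 g f.
Proof.
move=> [_ HM _] [fE gE fM]; split=> // x y /gE[xH xE] /gE[yH yE].
by rewrite -{1}xE -{1}yE -fM //; have [] := fE _ (HM _ _ xH yH).
Qed.

Lemma commensurable_sym (G1 G2 : groupType) :
  commensurable G1 G2 -> commensurable G2 G1.
Proof.
move=> /commensurableP[H1 [H2 [f [g [h1 h2 p]]]]]; apply/commensurableP.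
by exists H2, H1, g, f; split=> //; apply: partial_isom_sym p; case: h1.
Qed.

(** With [f] the identity this is the intersection of two finite-index
    subgroups. *)
Lemma fi_subgroup_preimage (G1 G2 : groupType) (H1 : set G1) (K : set G2)
    (f : G1 -> G2) :
    fi_subgroup H1 -> fi_subgroup K ->
    (forall x y, H1 x -> H1 y -> f (x * y)%g = (f x * f y)%g) ->
  fi_subgroup (H1 `&` [set x | K (f x)]).
Proof.
move=> [[H11 HM HV] [s1 s1E]] [[K1 KM KV] [s2 s2E]] fM.
have f1 : f 1%g = 1%g by apply: (@mulgI _ (f 1%g)); rewrite -fM // !mulg1.
have fV x : H1 x -> f (x^-1)%g = (f x)^-1%g.
  by move=> xH; apply/esym/mulg1_eq; rewrite -fM ?mulgV //; apply: HV.
split.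
  split=> [|x y [xH xK] [yH yK]|x [xH xK]] /=.
  - by split=> //=; rewrite f1.
  - by split; [apply: HM|rewrite /= fM //; apply: KM].
  - by split; [apply: HV|rewrite /= fV //; apply: KV].
(* each coset t K that meets f(H1) is represented by an element of H1 *)
have ex t : exists w, forall h, H1 h -> K (t^-1 * f h)%g ->
    H1 w /\ K (t^-1 * f w)%g.
  case: (pselect (exists h, H1 h /\ K (t^-1 * f h)%g)) => [[h hh]|nh].
    by exists h.
  by exists 1%g => h hH hK; case: nh; exists h.
have [w wE] := choice ex.
exists [seq (x * w t)%g | x <- s1, t <- s2] => g.
have [x xs xH] := s1E g; have [t ts tK] := s2E (f (x^-1 * g)%g).
have [wH wK] := wE t _ xH tK.
exists (x * w t)%g; first by apply/allpairsP; exists (x, t).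
have E : ((x * w t)^-1 * g = (w t)^-1 * (x^-1 * g))%g by rewrite invgM mulgA.
split; first by rewrite E; apply: HM => //; apply: HV.
rewrite /= E fM // ?fV //; last exact: HV.
set a := f (w t); set b := f _.
have -> : (a^-1 * b = (t^-1 * a)^-1 * (t^-1 * b))%g by rewrite invgM invgK mulgA mulgK.
by apply: KM => //; apply: KV.
Qed.

(** The intermediate subgroups are cut down to their common part in [G2]. *)
Lemma commensurable_trans (G1 G2 G3 : groupType) :
  commensurable G1 G2 -> commensurable G2 G3 -> commensurable G1 G3.
Proof.
move=> /commensurableP[H1 [H2 [f [g [h1 h2 pf]]]]].
move=> /commensurableP[K2 [K3 [h [k [k2 k3 ph]]]]].
have [_ _ kM] := partial_isom_sym (proj1 k2) ph.
case: pf ph => fE gE fM [hE kE hM].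
apply/commensurableP; exists (H1 `&` [set x | K2 (f x)]), (K3 `&` [set z | H2 (k z)]).
exists (h \o f), (g \o k); split; [exact: fi_subgroup_preimage..|split=> /=].
- move=> x [/fE[fxH fxE] fxK]; have [hK hkE] := hE _ fxK.
  by split; rewrite /= ?hkE.
- move=> z [/kE[kK kzE] kH]; have [gH gfE] := gE _ kH.
  by split; rewrite /= ?gfE.
- by move=> x y [xH xK] [yH yK]; rewrite fM // hM.
Qed.

Lemma fi_subgroupT (G : groupType) : fi_subgroup [set: G].
Proof. by split=> //; exists [:: 1%g] => g; exists 1%g; rewrite ?mem_seq1. Qed.

Lemma gisom_commensurable (G H : groupType) (f : G -> H) g :
  gisom f g -> commensurable G H.
Proof.
case=> fM gM fK gK; apply/commensurableP; exists setT, setT, f, g.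
by split; [exact: fi_subgroupT..|split].
Qed.

(** * Finite-index subgroups of free products *)

Definition zpow (G : groupType) (g : G) (z : int) : G :=
  match z with Posz n => (g ^+ n)%g | Negz n => (g ^- n.+1)%g end.

Lemma zpowD (G : groupType) (g : G) :
  {morph zpow g : a b / (a + b)%R >-> (a * b)%g}.
Proof.
have zS z : zpow g (z + 1) = (zpow g z * g)%g.
  case: z => [n|[|n]] /=; first by rewrite addn1 expgSr.
    by rewrite expg1 mulVg.
  by rewrite subn1 [in RHS]expgS invgM mulgVK.
have zP z : zpow g (z - 1) = (zpow g z * g^-1)%g.
  by rewrite -{2}[z](subrK 1) zS mulgK.
move=> a; elim/int_rect => [|n IH|n IH]; first by rewrite addr0 mulg1.
  by rewrite -addn1 PoszD addrA !zS IH mulgA.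
by rewrite -addn1 PoszD opprD addrA !zP IH mulgA.
Qed.

Lemma zpow1 (G : groupType) (g : G) : zpow g 1 = g.
Proof. exact: expg1. Qed.

Lemma zhomZ (V : zmodType) (G : groupType) (f : V -> G) a z :
    {morph f : a b / (a + b)%R >-> (a * b)%g} -> f (a *~ z) = zpow (f a) z.
Proof.
move=> fD; have fX n : f (a *+ n) = (f a ^+ n)%g.
  by elim: n => [|n IH]; rewrite ?mulr0n ?zhom0 // mulrS expgS fD IH.
by case: z => n; rewrite ?NegzE ?mulrNz ?(zhomN fD) /= ?fX.
Qed.

Section StabilizerAction.
Variables (I : finType) (A : I -> zmodType) (P : groupType).
Variables (X : finType) (x0 : X).
Variable al : forall i, A i -> X * P -> X * P.
Variables (phi : P -> freeprod A) (tau : X -> freeprod A).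
Hypothesis phiM : {morph phi : x y / (x * y)%g}.
Hypothesis tau0 : tau x0 = 1%g.
Hypothesis tauE : forall i (a : A i) x p,
  (tau (al a (x, p)).1 * phi (al a (x, p)).2 = finj a * (tau x * phi p))%g.
Hypothesis phiE : forall p, fp_act al (phi p) (x0, 1%g) = (x0, p).

(** The equivariant bijection [(x, p) |-> tau x * phi p] identifies the free
    product with [X * P], hence [P] with the stabilizer of [x0]. *)
Lemma commensurable_stabilizer : commensurable P (freeprod A).
Proof.
have equiv (w : freeprod A) z : (tau (fp_act al w z).1 * phi (fp_act al w z).2 =
    w * (tau z.1 * phi z.2))%g.
  rewrite [in RHS](freeprod_word w) /fp_act.
  elim: (val w) => [|x s IH]; first by rewrite big_nil mul1g.
  rewrite big_cons -[RHS]mulgA -IH [word_act _ _ _]/= .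
  by case: (word_act al s z) => y p; rewrite tauE.
have phiI : injective phi.
  by move=> p q E; have := phiE p; rewrite E phiE => -[].
have phi1 := ghom1 phiM; have phiV := ghomV phiM.
have ex g : exists p, range phi g -> phi p = g.
  by case: (pselect (range phi g)) => [[p _ <-]|n]; [exists p|exists 1%g => /n].
have [psi psiE] := choice ex.
apply/commensurableP; exists setT, (range phi), phi, psi; split.
- exact: fi_subgroupT.
- split; first split.
  + by exists 1%g.
  + by move=> _ _ [p _ <-] [q _ <-]; exists (p * q)%g.
  + by move=> _ [p _ <-]; exists (p^-1)%g.
  exists [seq tau x | x <- enum X] => g.
  have := equiv g (x0, 1%g); case: (fp_act al g _) => x p /=.
  rewrite tau0 phi1 !mulg1 => <-; exists (tau x); last first.
    by exists p; rewrite // mulKg.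
  by apply: map_f; rewrite mem_enum.
- split=> //.
  + by move=> p _; split; [exists p|apply: phiI; apply: psiE; exists p].
  + by move=> g gR; split=> //; apply: psiE.
Qed.

End StabilizerAction.

Section Kurosh.
Variables (I : finType) (A : I -> zmodType) (X : finType) (x0 : X).
(* an action of every factor on X, the representative rep i x of the A i-orbit
   of x, and an element sec i x that moves it to x *)
Variable sh : forall i, A i -> X -> X.
Hypothesis sh0 : forall i x, @sh i 0 x = x.
Hypothesis shD : forall i (a b : A i) x, sh (a + b) x = sh a (sh b x).
Variables (rep : I -> X -> X) (sec : forall i, X -> A i).
Hypothesis rep_sh : forall i (a : A i) x, rep i (sh a x) = rep i x.
Hypothesis sec_rep : forall i x, sh (sec i x) (rep i x) = x.
Hypothesis rep_rep : forall i x, rep i (rep i x) = rep i x.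
Hypothesis sec0 : forall i x, rep i x = x -> sec i x = 0.
(* the stabilizer of x in A i, as the image of kap *)
Variables (B : I -> X -> zmodType) (kap : forall i x, B i x -> A i).
Hypothesis kapD : forall i x, {morph @kap i x : a b / a + b}.
Hypothesis kapI : forall i x, injective (@kap i x).
Hypothesis kap_stab : forall i x (v : B i x), sh (kap v) x = x.
Hypothesis kap_onto : forall i x (a : A i), sh a x = x -> exists v : B i x, kap v = a.
(* A spanning tree of the graph whose vertices are the points of X and the orbits
   of all factors, with an edge (i, x) between x and its A i-orbit; tau x
   follows the tree from x0 to x, and mu decreases towards x0. *)
Variables (tree : I -> X -> bool) (tau : X -> freeprod A) (mu : X -> nat).
Hypothesis tau0 : tau x0 = 1%g.
Hypothesis tau_tree : forall i x, tree i x ->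
  tau x = (finj (sec i x) * tau (rep i x))%g.
Hypothesis tree_rep : forall i x, rep i x = x -> tree i x.
Hypothesis tree_down : forall x, x != x0 ->
  exists2 i, tree i x & (mu (rep i x) < mu x)%N.

Definition kurosh_idx := ({p : I * X | rep p.1 p.2 == p.2} + I * X)%type.

Definition kurosh_fam (j : kurosh_idx) : zmodType :=
  match j with
  | inl p => B (val p).1 (val p).2
  | inr p => 'rV[int]_(~~ tree p.1 p.2)
  end.

Let P : groupType := freeprod kurosh_fam.

Let stab_sec i (a : A i) x : sh (a + sec i x - sec i (sh a x)) (rep i x) = rep i x.
Proof.
rewrite addrC shD shD sec_rep -[X in sh _ X = _](sec_rep i (sh a x)).
rewrite -shD addNr sh0.
exact: rep_sh.
Qed.

Let kinv_ex : forall iy : I * X, exists k : A iy.1 -> B iy.1 iy.2,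
  forall a, sh a iy.2 = iy.2 -> kap (k a) = a.
Proof.
move=> [i y] /=.
have ex (a : A i) : exists v : B i y, sh a y = y -> kap v = a.
  by case: (pselect (sh a y = y)) => [/kap_onto[v]|n]; [exists v|exists 0 => /n].
by have [k kE] := choice ex; exists k.
Qed.

Let kinv i y (a : A i) : B i y := projT1 (cid (kinv_ex (i, y))) a.

Let kinvK i y (a : A i) : sh a y = y -> kap (kinv y a) = a.
Proof. exact: (projT2 (cid (kinv_ex (i, y)))). Qed.

Let vtx i y (h : rep i y == y) (a : A i) : P :=
  @finj _ kurosh_fam (inl (exist (fun p : I * X => is_true (rep p.1 p.2 == p.2)) (i, y) h))
     (kinv y a).

Let repP i x : rep i (rep i x) == rep i x.
Proof. exact/eqP. Qed.

Let vg i x (a : A i) : P := vtx (repP i x) a.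

Let vgE i y (h : rep i y == y) (a : A i) : vg y a = vtx h a.
Proof.
suff E z (hz : rep i z == z) : z = y -> vtx hz a = vtx h a by apply/E/eqP.
by move=> zy; subst z; rewrite (bool_irrelevance hz h).
Qed.

Let vg_rep i x y (a : A i) : rep i x = rep i y -> vg x a = vg y a.
Proof.
rewrite /vg => E; move: (repP i x) (repP i y); rewrite E => h h'.
by rewrite (bool_irrelevance h h').
Qed.

Let vgD i x (a b : A i) : sh a (rep i x) = rep i x -> sh b (rep i x) = rep i x ->
  vg x (a + b) = (vg x a * vg x b)%g.
Proof.
move=> ha hb; rewrite /vg /vtx -finjD; congr finj; apply: kapI.
by rewrite kapD !kinvK // shD hb.
Qed.

Let vg0 i x : vg x (0 : A i) = 1%g.
Proof. by apply: (@mulgI _ (vg x (0 : A i))); rewrite -vgD // addr0 mulg1. Qed.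

Let u i x : P := @finj _ kurosh_fam (inr (i, x)) (const_mx 1).

Let u_tree i x : tree i x -> u i x = 1%g.
Proof.
rewrite /u => t; rewrite -[RHS](zhom0 (@finjD _ kurosh_fam (inr (i, x)))).
by congr finj; apply/rowP => -[] /=; rewrite t.
Qed.

Let al i (a : A i) (z : X * P) : X * P :=
  (sh a z.1, (u i (sh a z.1) * vg z.1 (a + sec i z.1 - sec i (sh a z.1)) *
              (u i z.1)^-1 * z.2)%g).

Let al0 i z : @al i 0 z = z.
Proof.
case: z => x p; rewrite /al /= sh0; congr pair.
by rewrite add0r subrr vg0 mulg1 mulgV mul1g.
Qed.

Let alD i (a b : A i) z : al (a + b) z = al a (al b z).
Proof.
case: z => x p; rewrite /al /= shD; congr pair.
rewrite !mulgA mulgVK (vg_rep _ (rep_sh b x)) -[in RHS](mulgA (u _ _)) -vgD.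
- do 3!congr (_ * _)%g; congr vg.
  rewrite -[a + b + _]addrA [RHS]addrACA [X in _ = _ + X]addrC [RHS]addrA.
  by rewrite [X in _ = X - _ - _]addrAC addrK.
- by rewrite -[X in sh _ X](rep_sh b); rewrite stab_sec rep_sh.
- exact: stab_sec.
Qed.

Let al_mul i (a : A i) x p q :
  al a (x, (p * q)%g) = ((al a (x, p)).1, ((al a (x, p)).2 * q)%g).
Proof. by rewrite /al /= !mulgA. Qed.

Let f (j : kurosh_idx) : kurosh_fam j -> freeprod A :=
  match j with
  | inl p => fun v : B (val p).1 (val p).2 =>
      ((tau (val p).2)^-1 * finj (kap v) * tau (val p).2)%g
  | inr p => fun v : 'rV[int]_(~~ tree p.1 p.2) =>
      zpow ((tau p.2)^-1 * finj (sec p.1 p.2) * tau (rep p.1 p.2))%g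
           (\sum_k v 0 k)
  end.

Let fD j : {morph @f j : a b / (a + b)%R >-> (a * b)%g}.
Proof.
case: j => [[[i y] h]|[i x]] a b /=.
  by rewrite kapD finjD !mulgA mulgK.
by rewrite -zpowD -big_split; congr zpow; apply: eq_bigr => k _; rewrite mxE.
Qed.

(** The subgroup theorem for the stabilizer of [x0].  The factors of the
    stabilizer are the conjugates of stabilizers in [A i] of one point in each
    [A i]-orbit, and one infinite cyclic group for every edge outside the tree.
    It is enough to check on generators that [X * P -> G] is equivariant and that
    the orbit map of [(x0, 1)] is its inverse. *)
Lemma kurosh : commensurable (freeprod kurosh_fam) (freeprod A).
Proof.
have [phi phiM phiE] := free_homE (freeprod_free kurosh_fam) fD.
have phi1 := ghom1 phiM; have phiV := ghomV phiM.
have phi_u i x : phi (u i x) = ((tau x)^-1 * finj (sec i x) * tau (rep i x))%g.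
  case: (boolP (tree i x)) => [t|/negPf t].
    by rewrite u_tree // phi1 -mulgA -tau_tree // mulVg.
  rewrite phiE /= -[RHS]zpow1; congr zpow.
  rewrite (eq_bigr (fun=> 1)) => [|k _]; last by rewrite mxE.
  by rewrite sumr_const card_ord t.
have phi_vg i x (a : A i) : sh a (rep i x) = rep i x ->
    phi (vg x a) = ((tau (rep i x))^-1 * finj a * tau (rep i x))%g.
  by move=> h; rewrite phiE /= kinvK.
have al_rep i x p : al (sec i x) (rep i x, p) = (x, (u i x * p)%g).
  rewrite /al /= sec_rep (sec0 (rep_rep i x)) addr0 subrr vg0 mulg1.
  by rewrite (u_tree (tree_rep (rep_rep i x))) invg1 mulg1.
have tau_x0 x : fp_act al (tau x) (x0, 1%g) = (x, 1%g).
  have [n] := ubnP (mu x); elim: n x => // n IH x le_n.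
  case: (eqVneq x x0) => [->|/tree_down[i t lt]]; first by rewrite tau0.
  rewrite (tau_tree t) fp_actM // fp_act_inj // IH ?al_rep ?u_tree ?mulg1 //.
  exact: leq_trans lt _.
have tau_V x : fp_act al (tau x)^-1%g (x, 1%g) = (x0, 1%g).
  by rewrite -{1}(tau_x0 x) -fp_actM // mulVg.
have fp_actR w x p q : fp_act al w (x, (p * q)%g) =
    ((fp_act al w (x, p)).1, ((fp_act al w (x, p)).2 * q)%g).
  rewrite /fp_act; elim: (val w) => //= y s ->.
  by rewrite al_mul -surjective_pairing.
apply: (commensurable_stabilizer (al := al) phiM tau0).
  move=> i a x p; rewrite [(al _ _).1]/= [(al _ _).2]/=.
  set x' := sh a x; rewrite !phiM phiV !phi_u phi_vg; last exact: stab_sec.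
  rewrite rep_sh !mulgA !invgM !invgK !mulgA mulgV mul1g !mulgK.
  rewrite -(zhomN (@finjD _ A i)) -!finjD; congr (finj _ * _ * _)%g.
  by rewrite [sec i x' + _]addrC subrK addrK.
move=> p; rewrite [in LHS](freeprod_word p) [in RHS](freeprod_word p).
elim: (val p) => [|y s IH]; first by rewrite !big_nil phi1.
rewrite !big_cons phiM fp_actM // IH; set q := (\prod_(_ <- _) _)%g.
have fp_actR1 w x r : fp_act al w (x, r) =
    ((fp_act al w (x, 1%g)).1, ((fp_act al w (x, 1%g)).2 * r)%g).
  by rewrite -fp_actR mul1g.
rewrite fp_actR1.
suff -> : fp_act al (phi (fsyl y)) (x0, 1%g) = (x0, fsyl y) by [].
case: y => -[[[i y] h]|[i x]] v; rewrite /fsyl [tagged _]/=.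
  rewrite phiE /= !fp_actM // tau_x0 fp_act_inj // /al [(y, _).1]/= kap_stab addrK.
  rewrite (vgE h) (u_tree (tree_rep (eqP h))) invg1 mul1g !mulg1.
  rewrite fp_actR1 tau_V /= mul1g.
  congr (_, _); rewrite /vtx (_ : kinv y (kap v) = v) //.
  by apply: kapI; rewrite kinvK // kap_stab.
have u_fix : fp_act al (phi (u i x)) (x0, 1%g) = (x0, u i x).
  rewrite phi_u !fp_actM // tau_x0 fp_act_inj // al_rep fp_actR1 tau_V /=.
  by rewrite mul1g mulg1.
pose S r := fp_act al (phi r) (x0, 1%g) = (x0, r).
have SM r r' : S r -> S r' -> S (r * r')%g.
  by rewrite /S => h h'; rewrite phiM fp_actM // h' fp_actR1 h.
have SV r : S r -> S (r^-1)%g.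
  rewrite /S phiV => h.
  have : fp_act al (phi r)^-1%g (x0, r) = (x0, 1%g) by rewrite -h -fp_actM // mulVg.
  rewrite fp_actR1; case: (fp_act _ _ _) => y r' /= [-> /eqP].
  by rewrite mulg_eq1 => /eqP ->.
have SX n : S (u i x ^+ n)%g.
  by elim: n => [|n h]; [rewrite /S phi1|rewrite expgS; apply: SM].
suff E : finj (v : kurosh_fam (inr (i, x))) = zpow (u i x) (\sum_k v 0 k).
  rewrite -/(S _) E.
  by case: (\sum_k _) => m; [exact: SX|apply: SV; apply: SX].
rewrite /u -(zhomZ _ _ (@finjD _ kurosh_fam (inr (i, x)))); congr finj.
apply/rowP => k; rewrite /kurosh_fam /= in k v *.
have -> : (const_mx 1 *~ (\sum_k0 v 0 k0) : 'rV[int]_(~~ tree i x)) 0 k = \sum_k0 v 0 k0.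
  by rewrite -scaler_int mxE mxE mulr1 intz.
rewrite (bigD1 k) //= big1 ?addr0 // => l /eqP[]; apply/val_inj.
have := leq_trans (ltn_ord l) (leq_b1 _); have := leq_trans (ltn_ord k) (leq_b1 _).
by rewrite !ltnS !leqn0 => /eqP hk /eqP hl; rewrite /= hk hl.
Qed.

End Kurosh.

(** * Free products of free abelian groups *)

Definition lattices (J : finType) (rho : J -> nat) (j : J) : zmodType :=
  'rV[int]_(rho j).

Definition multiplicity (J : finType) (rho : J -> nat) (s : nat) : nat :=
  \sum_j (rho j == s).

(** Truncation or padding with zeros: the identity when [m = n], without a
    cast. *)
Definition resize m n (v : 'rV[int]_m) : 'rV[int]_n :=
  \row_k (if insub (val k) is Some l then v 0 l else 0).

Lemma resizeD m n : {morph @resize m n : u v / u + v}.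
Proof.
by move=> u v; apply/rowP => k; rewrite !mxE; case: insubP => [l _ _|_];
  rewrite ?mxE ?addr0.
Qed.

Lemma resizeK m n (v : 'rV[int]_m) : m = n -> resize m (resize n v) = v.
Proof.
by move=> mn; subst n; apply/rowP => k; rewrite !mxE valK mxE valK.
Qed.

Section SameMultiplicities.
Variables (J J' : finType) (rho : J -> nat) (rho' : J' -> nat).
Hypothesis same : forall s, (0 < s)%N -> multiplicity rho s = multiplicity rho' s.

Let fiber (K : finType) (r : K -> nat) s := [seq k <- enum K | r k == s].

Let size_fiber (K : finType) (r : K -> nat) s : size (fiber r s) = multiplicity r s.
Proof.
by rewrite /multiplicity size_filter -sum1_count big_mkcond -big_enum /=;
  apply: eq_bigr => k _; case: eqP.
Qed.

(** The [k]-th index of rank [s] in [J] is matched with the [k]-th index of rank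
    [s] in [J']. *)
Definition match_index j := onth (fiber rho' (rho j)) (index j (fiber rho (rho j))).

Definition match_map j (v : lattices rho j) : freeprod (lattices rho') :=
  if match_index j is Some j' then finj (resize (rho' j') v : lattices rho' j') else 1%g.

Lemma match_mapD j : {morph @match_map j : a b / (a + b)%R >-> (a * b)%g}.
Proof.
rewrite /match_map; case: (match_index j) => [j'|] a b; last by rewrite mulg1.
by rewrite resizeD finjD.
Qed.

Lemma match_indexP j : (0 < rho j)%N ->
  exists j', [/\ match_index j = Some j', rho' j' = rho j &
    index j' (fiber rho' (rho j)) = index j (fiber rho (rho j))].
Proof.
rewrite /match_index => j0; set s := rho j in j0 *.
have jF : j \in fiber rho s by rewrite mem_filter eqxx mem_enum.
have lt : (index j (fiber rho s) < size (fiber rho' s))%N.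
  by rewrite size_fiber -same // -size_fiber index_mem.
have : onth (fiber rho' s) (index j (fiber rho s)) by rewrite onthTE.
case E: (onth _ _) => [j'|] // _; exists j'.
have j'E := @onth_nth _ j' _ _ _ E; split=> //.
  by have := mem_nth j' lt; rewrite j'E mem_filter => /andP[/eqP].
by rewrite -[in LHS]j'E index_uniq // filter_uniq // enum_uniq.
Qed.

Lemma match_indexK j j' : (0 < rho j)%N -> match_index j = Some j' ->
  onth (fiber rho (rho' j')) (index j' (fiber rho' (rho' j'))) = Some j.
Proof.
move=> /match_indexP[k [-> kj ik]] [<-].
rewrite kj ik; set s := rho j.
have jF : j \in fiber rho s by rewrite mem_filter eqxx mem_enum.
have : onth (fiber rho s) (index j (fiber rho s)) by rewrite onthTE index_mem.
case E: (onth _ _) => [l|] // _.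
by have := @onth_nth _ j _ _ _ E; rewrite nth_index // => ->.
Qed.

End SameMultiplicities.

Lemma match_mapK (J J' : finType) (rho : J -> nat) (rho' : J' -> nat) :
    (forall s, (0 < s)%N -> multiplicity rho s = multiplicity rho' s) ->
    forall (phi : freeprod (lattices rho) -> freeprod (lattices rho'))
           (psi : freeprod (lattices rho') -> freeprod (lattices rho)),
    {morph phi : x y / (x * y)%g} -> {morph psi : x y / (x * y)%g} ->
    (forall j v, phi (finj v) = match_map rho' (v : lattices rho j)) ->
    (forall j v, psi (finj v) = match_map rho (v : lattices rho' j)) ->
  forall j (v : lattices rho j), psi (phi (finj v)) = finj v.
Proof.
move=> same phi psi phiM psiM phiE psiE j v.
have [j0|] := ltnP 0 (rho j); last first.
  rewrite leqn0 => /eqP j0; have -> : v = 0.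
    by apply/rowP => k; have := ltn_ord k; rewrite {2}j0.
  by rewrite (zhom0 (@finjD _ _ j)) (ghom1 phiM) (ghom1 psiM).
have [k [mk kj _]] := match_indexP same j0.
rewrite phiE /match_map mk psiE /match_map.
have := match_indexK same j0 mk; rewrite -/(match_index rho' rho k) => ->.
by congr finj; apply: resizeK; rewrite kj.
Qed.

(** Rank 0 factors are trivial, so multiplicities are compared for positive
    ranks only; this absorbs the trivial factors that covers produce. *)
Lemma commensurable_multiplicity (J J' : finType) (rho : J -> nat) (rho' : J' -> nat) :
    (forall s, (0 < s)%N -> multiplicity rho s = multiplicity rho' s) ->
  commensurable (freeprod (lattices rho)) (freeprod (lattices rho')).
Proof.
move=> same.
have [phi phiM phiE] := free_homE (freeprod_free _) (@match_mapD J J' rho rho').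
have [psi psiM psiE] := free_homE (freeprod_free _) (@match_mapD J' J rho' rho).
apply: (gisom_commensurable (f := phi) (g := psi)).
apply: (free_isom (freeprod_free _) (freeprod_free _)) => //.
  exact: (match_mapK same phiM psiM phiE psiE).
by apply: (match_mapK _ psiM phiM psiE phiE) => s s0; rewrite same.
Qed.

(** * Lists of ranks *)

Definition lattice_prod (L : seq nat) : groupType :=
  freeprod (lattices (fun k : 'I_(size L) => nth 0%N L k)).

Lemma multiplicity_nth (L : seq nat) s :
  multiplicity (fun k : 'I_(size L) => nth 0%N L k) s = count_mem s L.
Proof.
rewrite -sum1_count (big_nth 0%N) big_mkcond /= big_mkord.
by apply: eq_bigr => k _; case: eqP.
Qed.

Lemma lattice_prod_count L L' : (forall s, (0 < s)%N -> count_mem s L = count_mem s L') ->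
  commensurable (lattice_prod L) (lattice_prod L').
Proof.
by move=> E; apply: commensurable_multiplicity => s s0; rewrite !multiplicity_nth E.
Qed.

Lemma commensurable_lattice_prod (J : finType) (rho : J -> nat) :
  commensurable (freeprod (lattices rho))
    (lattice_prod [seq rho j | j <- enum J & (0 < rho j)%N]).
Proof.
apply: commensurable_multiplicity => s s0; rewrite multiplicity_nth.
apply/esym; rewrite count_map count_filter /multiplicity -sum1_count big_mkcond.
rewrite -[RHS]big_enum /=; apply: eq_bigr => j _ /=; case: eqP => //= ->.
by rewrite s0.
Qed.

Definition first n (a : 'rV[int]_n) : int := \sum_(k | val k == 0%N) a 0 k.

Definition axis n (z : int) : 'rV[int]_n := \row_k (if val k == 0%N then z else 0).

(** The isomorphism of [Z^n] with the subgroup of index [d] on which the first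
    coordinate is divisible by [d]. *)
Definition stretch n (d : int) (v : 'rV[int]_n) : 'rV[int]_n :=
  \row_k (if val k == 0%N then d * v 0 k else v 0 k).

Lemma firstD n : {morph @first n : a b / a + b}.
Proof. by move=> a b; rewrite -big_split; apply: eq_bigr => k _; rewrite mxE. Qed.

Lemma first0 n : first (0 : 'rV[int]_n) = 0.
Proof. by rewrite /first big1 // => k _; rewrite mxE. Qed.

Lemma firstE n (h : (0 < n)%N) (a : 'rV[int]_n) : first a = a 0 (Ordinal h).
Proof.
rewrite /first (bigD1 (Ordinal h)) //= big1 ?addr0 // => k /andP[/eqP k0 /eqP[]].
by apply/val_inj.
Qed.

Section CyclicCover.
Variables (J : finType) (rho : J -> nat) (d : nat).
Variables (eps : {pred J}) (j0 : J).
Hypothesis eps_j0 : j0 \in eps.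
Hypothesis eps_gt0 : forall j, j \in eps -> (0 < rho j)%N.

Let X : finType := 'I_d.+1.
Let one : 'I_d.+1 := inZp 1.

Let one_mul (x : X) : one *+ (x : nat) = x.
Proof. by apply/val_inj; rewrite Zp_mulrn /= modnMml mul1n modn_small. Qed.

Let one_eq0 z : (one *~ z == 0) = (d.+1 %| z)%Z.
Proof.
have E n : (one *+ n == 0) = (d.+1 %| n)%N.
  by rewrite -val_eqE Zp_mulrn /= modnMml mul1n.
by case: z => n; rewrite ?NegzE ?mulrNz ?oppr_eq0 ?dvdzN -pmulrn E.
Qed.

(* Factors in eps translate Z/(d+1) by their first coordinate, the others act
   trivially; the tree joins all points to the single orbit of the factor j0. *)
Let sh j (a : lattices rho j) (x : X) : X := if j \in eps then x + one *~ first a else x.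
Let rep j (x : X) : X := if j \in eps then 0 else x.
Let sec j (x : X) : lattices rho j :=
  if j \in eps then axis (rho j) (x : nat)%:Z else 0.
Let kap j (x : X) (v : 'rV[int]_(rho j)) : lattices rho j :=
  if j \in eps then stretch d.+1 v else v.
Let tree j (x : X) := [|| j \notin eps, j == j0 | x == 0].
Let tau (x : X) : freeprod (lattices rho) := finj (sec j0 x).

Let first_axis j z : j \in eps -> first (axis (rho j) z) = z.
Proof. by move=> /eps_gt0 h; rewrite (firstE h) mxE. Qed.

Let sec_0 j : sec j 0 = 0.
Proof. by rewrite /sec; case: ifP => // _; apply/rowP => k; rewrite !mxE; case: ifP. Qed.

Definition cover_idx : finType := kurosh_idx rep.
Definition cover_rank (j : cover_idx) : nat :=
  match j with
  | inl p => rho (val p).1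
  | inr p => ~~ tree p.1 p.2
  end.

Lemma cyclic_cover :
  commensurable (freeprod (lattices cover_rank)) (freeprod (lattices rho)).
Proof.
suff E : lattices cover_rank = kurosh_fam (rep := rep) (fun j _ => 'rV[int]_(rho j)) tree.
  rewrite E; apply: (@kurosh J (lattices rho) X 0 sh _ _ rep sec _ _ _ _
   (fun j _ => 'rV[int]_(rho j)) kap _ _ _ _ tree tau (fun x => x)) => {E}.
  - by move=> j x; rewrite /sh; case: ifP => // _; rewrite first0 mulr0z addr0.
  - move=> j a b x; rewrite /sh; case: ifP => // _.
    by rewrite firstD mulrzDr [X in x + X]addrC addrA.
  - by move=> j a x; rewrite /rep /sh; case: (j \in eps).
  - move=> j x; rewrite /sh /sec /rep; case: (boolP (j \in eps)) => // e.
    by rewrite first_axis // add0r -pmulrn one_mul.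
  - by move=> j x; rewrite /rep; case: (j \in eps).
  - by move=> j x; rewrite /rep /sec; case: (boolP (j \in eps)) => // e <-;
      have := sec_0 j; rewrite /sec e.
  - move=> j x u v; rewrite /kap; case: (boolP (j \in eps)) => // _; apply/rowP => k; rewrite !mxE.
    by case: ifP => // _; rewrite mulrDr.
  - move=> j x u v; rewrite /kap; case: (boolP (j \in eps)) => // _ /rowP E; apply/rowP => k.
    by have := E k; rewrite !mxE; case: ifP => // _; apply: mulfI.
  - move=> j x v; rewrite /sh /kap; case: (boolP (j \in eps)) => // e.
    rewrite (firstE (eps_gt0 e)) /stretch mxE /= (_ : one *~ _ = 0) ?addr0 //.
    by apply/eqP; rewrite one_eq0 dvdz_mulr.
  - move=> j x a; rewrite /sh /kap; case: (boolP (j \in eps)) => e; last by exists a.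
    move=> /eqP; rewrite -[X in _ == X]addr0 (inj_eq (addrI x)) one_eq0.
    rewrite (firstE (eps_gt0 e)) => /divzK ak.
    pose a' : 'rV[int]_(rho j) := a.
    exists (\row_k (if val k == 0%N then divz (a' 0 k) d.+1 else a' 0 k)).
    apply/rowP => k; rewrite !mxE; case: (boolP (val k == 0%N)) => // k0.
    rewrite mulrC.
    by rewrite (_ : k = Ordinal (eps_gt0 e)) //; apply/val_inj/eqP.
  - by rewrite /tau sec_0 (zhom0 (@finjD _ _ j0)).
  - move=> j x; rewrite /tree => /or3P[|/eqP->|/eqP->].
    + by rewrite /rep /sec => /negPf ->; rewrite (zhom0 (@finjD _ _ j)) mul1g.
    + by rewrite /tau /rep eps_j0 sec_0 (zhom0 (@finjD _ _ j0)) mulg1.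
    + by rewrite sec_0 (zhom0 (@finjD _ _ j)) mul1g /rep; case: (_ \in _).
  - by move=> j x; rewrite /rep /tree; case: (boolP (j \in eps)) => //= _ <-; rewrite eqxx orbT.
  - move=> x x0; exists j0; first by rewrite /tree eqxx orbT.
    by rewrite /rep eps_j0 /= lt0n.
by apply/funext => -[].
Qed.

(** A factor in [eps] has one orbit, the others have [d + 1]; each factor in
    [eps] other than [j0] leaves [d] edges outside the tree. *)
Lemma cover_multiplicity s : (0 < s)%N -> multiplicity cover_rank s =
  (\sum_j (rho j == s) * (if j \in eps then 1 else d.+1) +
   (s == 1) * (d * (#|eps|.-1)))%N.
Proof.
move=> s0; rewrite /multiplicity big_sumType /=; congr (_ + _)%N.
  transitivity (\sum_(p : J * X | rep p.1 p.2 == p.2) (rho p.1 == s))%N.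
    rewrite [RHS](reindex_omap (val : {p : J * X | rep p.1 p.2 == p.2} -> _) insub).
      by apply: eq_bigl => -[p hp] /=; rewrite insubT hp /= eqxx.
    by move=> p hp; rewrite insubT.
  rewrite -(pair_big_dep xpredT (fun j x => rep j x == x) (fun j _ => rho j == s : nat)).
  apply: eq_bigr => j _ /=; rewrite sum_nat_const mulnC; congr (_ * _)%N.
  rewrite /rep; case: (boolP (j \in eps)) => e.
    by rewrite -(card1 (0 : X)); apply: eq_card => x; rewrite !inE eq_sym.
  by rewrite -[RHS](card_ord d.+1); apply: eq_card => x; apply: eqxx.
case: (eqVneq s 1%N) => [->|s1]; last first.
  rewrite mul0n big1 // => -[j x] _ /=.
  by case: (tree j x) => /=; case: s s0 s1 => [|[]].
transitivity (\sum_(p : J * X) (~~ tree p.1 p.2 : nat))%N.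
  by apply: eq_bigr => -[j x] _ /=; case: (tree j x).
rewrite -(pair_bigA _ (fun j x => ~~ tree j x : nat)) mul1n /=.
transitivity (\sum_(j in [predD1 eps & j0]) d)%N; last first.
  rewrite sum_nat_const mulnC; congr (_ * _)%N.
  by rewrite (cardD1 j0 eps) eps_j0.
rewrite [RHS]big_mkcond; apply: eq_bigr => j _ /=.
rewrite inE /= /tree andbC; case: (boolP (j \in eps)) => e /=; last by rewrite big1.
case: eqP => _ /=; first by rewrite big1.
transitivity #|predC1 (0 : X)|; last by rewrite cardC1 card_ord.
by rewrite -sum1_card [RHS]big_mkcond; apply: eq_bigr => x _; rewrite inE; case: eqP.
Qed.

End CyclicCover.

Definition all_pos (L : seq nat) := all (fun n => 0 < n)%N L.

(** Every factor acts transitively on [Z/(d+1)], hence is kept once. *)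
Lemma lattice_prod_cover_all n L d : all_pos (n :: L) ->
  commensurable (lattice_prod (n :: L)) (lattice_prod (n :: L ++ nseq (d * size L) 1%N)).
Proof.
move=> /allP pos; pose K := n :: L; pose rho (k : 'I_(size K)) := nth 0%N K k.
have rho_gt0 k : k \in (predT : pred 'I_(size K)) -> (0 < rho k)%N.
  by move=> _; apply: pos; apply: mem_nth.
apply: commensurable_sym.
have h := @cyclic_cover _ rho d predT ord0 isT rho_gt0.
apply: commensurable_trans h; apply: commensurable_multiplicity => s s0.
rewrite multiplicity_nth (cover_multiplicity _ _ isT) // cardT size_enum_ord /=.
rewrite count_cat count_nseq /= addnA [(1 == s)%N]eq_sym; congr (_ + _)%N.
by rewrite -[LHS]/(count_mem s K) -multiplicity_nth; apply: eq_bigr => k _; rewrite muln1.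
Qed.

(** All factors but the first act transitively on [Z/2]: only the first one is
    doubled. *)
Lemma lattice_prod_cover_but m n L : all_pos (m :: n :: L) ->
  commensurable (lattice_prod (m :: n :: L)) (lattice_prod (m :: m :: n :: L ++ nseq (size L) 1%N)).
Proof.
move=> /allP pos; pose K := [:: m, n & L]; pose rho (k : 'I_(size K)) := nth 0%N K k.
pose eps := predC1 (ord0 : 'I_(size K)).
have rho_gt0 k : k \in eps -> (0 < rho k)%N.
  by move=> _; apply: pos; apply: mem_nth.
have o1 : (1 < size K)%N by [].
have e1 : Ordinal o1 \in eps by [].
apply: commensurable_sym.
have h := @cyclic_cover _ rho 1 eps (Ordinal o1) e1 rho_gt0.
apply: commensurable_trans h; apply: commensurable_multiplicity => s s0.
rewrite multiplicity_nth (cover_multiplicity _ _ e1) // cardC1 card_ord mul1n /=.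
rewrite count_cat count_nseq /= !addnA [(1 == s)%N]eq_sym; congr (_ + _)%N.
rewrite big_ord_recl /= muln2 -addnn -!addnA; do 2!congr (_ + _)%N.
rewrite -[LHS]/(count_mem s (n :: L)) -multiplicity_nth.
by apply: eq_bigr => k _; rewrite muln1.
Qed.

Lemma lattice_prod_dup m L : (1 < size L)%N -> all_pos L -> m \in L ->
  commensurable (lattice_prod L) (lattice_prod (m :: L ++ nseq (size L - 2) 1%N)).
Proof.
move=> sL pos mL; have pL := perm_to_rem mL.
case E: (rem m L) pL => [|n L'] pL.
  by move: sL; rewrite (perm_size pL).
apply: (commensurable_trans (G2 := lattice_prod [:: m, n & L'])).
  by apply: lattice_prod_count => s _; apply/permP.
have pos' : all_pos [:: m, n & L'] by rewrite /all_pos -(perm_all _ pL).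
apply: (commensurable_trans (lattice_prod_cover_but pos')); apply: lattice_prod_count => s _.
rewrite (perm_size pL) /= subn2 /= !count_cat.
by rewrite (permP pL) /= !addnA.
Qed.

Lemma all_pos_cat L L' : all_pos (L ++ L') = all_pos L && all_pos L'.
Proof. exact: all_cat. Qed.

Lemma all_pos_ones k : all_pos (nseq k 1%N).
Proof. by rewrite /all_pos all_nseq orbT. Qed.

Lemma lattice_prod_absorb D L : (1 < size L)%N -> all_pos L -> {subset D <= L} ->
  exists k, commensurable (lattice_prod L) (lattice_prod (D ++ L ++ nseq k 1%N)).
Proof.
move=> sL pos; elim: D => [|m D IH] sD.
  by exists 0%N; apply: lattice_prod_count => s _; rewrite /= cats0.
have [k hk] : exists k, commensurable (lattice_prod L) (lattice_prod (D ++ L ++ nseq k 1%N)).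
  by apply: IH => x xD; apply: sD; rewrite inE xD orbT.
have mL : m \in L by apply: sD; rewrite inE eqxx.
set M := D ++ _ in hk; have mM : m \in M by rewrite !mem_cat mL orbT.
have posM : all_pos M.
  rewrite !all_pos_cat pos all_pos_ones /= andbT.
  by apply/allP => x xD; move/allP: pos; apply; apply: sD; rewrite inE xD orbT.
have sM : (1 < size M)%N by apply: (leq_trans sL); rewrite /M !size_cat addnCA leq_addr.
exists (k + (size M - 2))%N; apply: (commensurable_trans hk).
apply: (commensurable_trans (lattice_prod_dup sM posM mM)); apply: lattice_prod_count => s _.
by rewrite /= !count_cat !count_nseq; lia.
Qed.

(** Both sides of [a + (q - 1) p = b + (p - 1) q] count the copies of [Z] in a
    common finite-index subgroup, where [p + 1] and [q + 1] are the lengths of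
    the two lists: indeed [p - a = q - b]. *)
Lemma lattice_prod_ones M a b : all_pos M -> (1 < size M + a)%N -> (1 < size M + b)%N ->
  commensurable (lattice_prod (M ++ nseq a 1%N)) (lattice_prod (M ++ nseq b 1%N)).
Proof.
move=> pos ha hb.
have cov c d : (1 < size M + c)%N ->
    commensurable (lattice_prod (M ++ nseq c 1%N))
                  (lattice_prod (M ++ nseq (c + d * (size M + c - 1)) 1%N)).
  move=> hc; case E: (M ++ nseq c 1%N) => [|n L].
    by move/(congr1 size): E hc; rewrite size_cat size_nseq /= => ->.
  have posE : all_pos (n :: L) by rewrite -E all_pos_cat pos all_pos_ones.
  apply: (commensurable_trans (lattice_prod_cover_all d posE)); apply: lattice_prod_count => s _.
  have sL : size L = (size M + c - 1)%N.
    by move/(congr1 size): E; rewrite size_cat size_nseq /= => ->; rewrite subn1.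
  rewrite -cat_cons -E sL !count_cat !count_nseq; lia.
pose p := (size M + a - 1)%N; pose q := (size M + b - 1)%N.
have := cov a (q - 1)%N ha; have := cov b (p - 1)%N hb.
have -> : (b + (p - 1) * (size M + b - 1) = a + (q - 1) * (size M + a - 1))%N.
  by rewrite /p /q; nia.
move=> /commensurable_sym hb' ha'; exact: commensurable_trans ha' hb'.
Qed.

(** Absorbing into each list the ranks [>= 2] of the other one makes the two
    lists agree up to entries 1. *)
Lemma lattice_prod_same_ranks L L' :
    (1 < size L)%N -> (1 < size L')%N -> all_pos L -> all_pos L' ->
    (forall s, (2 <= s)%N -> (s \in L) = (s \in L')) ->
  commensurable (lattice_prod L) (lattice_prod L').
Proof.
move=> sL sL' pL pL' E; pose D := filter (leq 2) L; pose D' := filter (leq 2) L'.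
have [k hk] : exists k, commensurable (lattice_prod L) (lattice_prod (D' ++ L ++ nseq k 1%N)).
  by apply: lattice_prod_absorb => // s; rewrite mem_filter => /andP[s2]; rewrite E.
have [k' hk'] : exists k, commensurable (lattice_prod L') (lattice_prod (D ++ L' ++ nseq k 1%N)).
  by apply: lattice_prod_absorb => // s; rewrite mem_filter => /andP[s2]; rewrite -E.
have size_split K : all_pos K -> size K = (size (filter (leq 2) K) + count_mem 1%N K)%N.
  move=> pK; rewrite size_filter -(count_predC (leq 2) K); congr (_ + _)%N.
  by apply: eq_in_count => s /(allP pK) /=; case: s => [|[]].
have split_count K s : (0 < s)%N -> count_mem s K =
    (count_mem s (filter (leq 2) K) + (s == 1) * count_mem 1 K)%N.
  move=> s0; rewrite count_filter; case: (eqVneq s 1%N) => [->|s1].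
    suff -> : count (predI (pred1 1%N) (leq 2)) K = 0%N by rewrite mul1n.
    apply/eqP; rewrite -leqn0 leqNgt -has_count; apply/hasPn => x _ /=.
    by case: eqP => // ->.
  rewrite mul0n addn0; apply: eq_in_count => x _ /=.
  by case: eqP => // ->; case: s s0 s1 => [|[]].
have sub K : all_pos (filter (leq 2) K).
  by apply/allP => s; rewrite mem_filter => /andP[s2 _]; apply: ltnW.
apply: (commensurable_trans hk); apply: commensurable_trans (commensurable_sym hk').
apply: (commensurable_trans (G2 := lattice_prod ((D ++ D') ++ nseq (k + count_mem 1%N L) 1%N))).
  apply: lattice_prod_count => s s0; rewrite !count_cat !count_nseq (split_count L s s0) -/D.
  by rewrite /= [(1 == s)%N]eq_sym; case: (s == 1%N); lia.
apply: (commensurable_trans (G2 := lattice_prod ((D ++ D') ++ nseq (k' + count_mem 1%N L') 1%N))).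
  apply: lattice_prod_ones; first by rewrite all_pos_cat !sub.
    apply: (leq_trans sL); rewrite (size_split L pL) size_cat.
    by rewrite -addnA leq_add2l addnA leq_addl.
  apply: (leq_trans sL'); rewrite (size_split L' pL') size_cat.
  by rewrite [(size D + _)%N]addnC -addnA leq_add2l addnA leq_addl.
apply: lattice_prod_count => s s0; rewrite !count_cat !count_nseq (split_count L' s s0) -/D'.
by rewrite /= [(1 == s)%N]eq_sym; case: (s == 1%N); lia.
Qed.

(** * Passing to a torsion-free finite-index subgroup *)

Section TorsionFreeCover.
Variables (I : finType) (A : I -> zmodType) (n : I -> nat) (T : I -> finZmodType).
Variable f : forall i, {additive A i -> ('rV[int]_(n i) * T i)%type}.
Variable g : forall i, ('rV[int]_(n i) * T i)%type -> A i.
Hypothesis fK : forall i, cancel (f i) (@g i).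
Hypothesis gK : forall i, cancel (@g i) (f i).

Let gD i : {morph @g i : a b / a + b}.
Proof. by move=> a b; apply: (can_inj (fK (i := i))); rewrite raddfD !gK. Qed.

Let g0 i : g (0, 0) = 0 :> A i.
Proof. by rewrite -[RHS](fK (i := i)) raddf0. Qed.

Let X : finType := {dffun forall i, T i}.
Let x0 : X := [ffun i => 0].
Let upd (x : X) i (t : T i) : X := [ffun k => dfwith (fun k => x k) t k].

Let upd_in x i (t : T i) : upd x t i = t.
Proof. by rewrite ffunE dfwith_in. Qed.

Let upd_out x i (t : T i) k : i != k -> upd x t k = x k.
Proof. by move=> ik; rewrite ffunE dfwith_out. Qed.

Let updE (x : X) i (y : X) (t : T i) :
  y i = t -> (forall k, i != k -> y k = x k) -> upd x t = y.
Proof.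
move=> yi yk; apply/ffunP => k; case: (eqVneq i k) => [<-|ik].
  by rewrite upd_in yi.
by rewrite upd_out ?yk.
Qed.

Let sh i (a : A i) (x : X) : X := upd x (x i + (f i a).2).
Let rep i (x : X) : X := upd x (0 : T i).
Let sec i (x : X) : A i := g (0, x i).
Let kap i (x : X) (v : 'rV[int]_(n i)) : A i := g (v, 0).
(* The tree joins x to its A i-orbit when x i = 0, so that x represents the orbit,
   or when i is the first nonzero coordinate of x; going down the tree clears the
   coordinates from the first to the last. *)
Let before i := take (index i (enum I)) (enum I).
Let tree i (x : X) := (x i == 0) || all (fun k => x k == 0) (before i).
Let tau (x : X) : freeprod A := (\prod_(i <- enum I) finj (sec i x))%g.
Let mu (x : X) : nat := #|[pred k | x k != 0]|.

Let rep_id i (x : X) : x i = 0 -> rep i x = x.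
Proof. by move=> xi; apply: updE. Qed.

Let sec_id i (x : X) : x i = 0 -> sec i x = 0.
Proof. by rewrite /sec => ->. Qed.

Let sec1 i (x : X) : x i = 0 -> finj (sec i x) = 1%g.
Proof. by move=> /sec_id ->; rewrite (zhom0 (@finjD _ _ i)). Qed.

Let memB i k : k \in before i = (index k (enum I) < index i (enum I))%N.
Proof. by rewrite in_take // mem_enum. Qed.

Let enum_split i : exists s, enum I = before i ++ i :: s /\ i \notin s.
Proof.
have iI : (index i (enum I) < size (enum I))%N by rewrite index_mem mem_enum.
exists (drop (index i (enum I)).+1 (enum I)).
have E : enum I = before i ++ i :: drop (index i (enum I)).+1 (enum I).
  rewrite -{1}(cat_take_drop (index i (enum I)) (enum I)); congr (_ ++ _).
  by rewrite (drop_nth i) // nth_index // mem_enum.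
split=> //; have := enum_uniq I; rewrite {1}E cat_uniq /=.
by case/and4P.
Qed.

Definition tf_idx : finType := kurosh_idx rep.
Definition tf_rank (j : tf_idx) : nat :=
  match j with
  | inl p => n (val p).1
  | inr p => ~~ tree p.1 p.2
  end.

Lemma torsion_free_cover : commensurable (freeprod (lattices tf_rank)) (freeprod A).
Proof.
suff E : lattices tf_rank = kurosh_fam (rep := rep) (fun i _ => 'rV[int]_(n i)) tree.
  rewrite E; apply: (@kurosh I A X x0 sh _ _ rep sec _ _ _ _
   (fun i _ => 'rV[int]_(n i)) kap _ _ _ _ tree tau mu) => {E}.
  - by move=> i x; apply: updE => //; rewrite raddf0 addr0.
  - move=> i a b x; apply: updE; first by rewrite !upd_in raddfD /= [(f i a).2 + _]addrC addrA.
    by move=> k ik; rewrite !upd_out.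
  - move=> i a x; apply: updE => [|k ik]; first by rewrite upd_in.
    by rewrite !upd_out.
  - move=> i x; apply: updE => [|k ik]; first by rewrite upd_in gK add0r.
    by rewrite upd_out.
  - by move=> i x; apply: rep_id; rewrite upd_in.
  - by move=> i x E; apply: sec_id; rewrite -E upd_in.
  - by move=> i x u v; rewrite /kap -gD; congr g; congr pair; rewrite addr0.
  - by move=> i x u v /(can_inj (gK (i := i))) [].
  - by move=> i x v; apply: updE => //; rewrite gK addr0.
  - move=> i x a /(congr1 (fun y : X => y i)); rewrite upd_in => /eqP.
    rewrite -[X in _ == X]addr0 (inj_eq (addrI _)) => /eqP a0.
    by exists (f i a).1; rewrite /kap -[in LHS]a0 -surjective_pairing fK.
  - rewrite /tau big1_seq // => i _.
    by rewrite sec1 // ffunE.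
  - move=> i x /orP[/eqP xi|/allP xB]; first by rewrite sec1 // mul1g rep_id.
    have [s [E iNs]] := enum_split i.
    rewrite /tau E !big_cat /= !big_cons.
    rewrite big1_seq => [|k /= kB]; last by rewrite sec1 //; apply/eqP/xB.
    rewrite [in RHS]big1_seq => [|k /= kB]; last first.
      rewrite sec1 // upd_out; first exact/eqP/xB.
      by apply: contraTneq kB => <-; rewrite memB ltnn.
    rewrite !mul1g (sec1 (upd_in _ _)) mul1g; congr (_ * _)%g.
    apply: eq_big_seq => k ks; rewrite /sec upd_out //.
    by apply: contraNneq iNs => ->.
  - by move=> i x <-; rewrite /tree upd_in eqxx.
  - move=> x xx0; have hs : has (fun i => x i != 0) (enum I).
      apply: contraNT xx0 => /hasPn h; apply/eqP/ffunP => i; rewrite ffunE.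
      by apply/eqP; have := h i (mem_enum _ i); rewrite negbK.
    have [i _ _] := hasP hs.
    set k := nth i (enum I) (find (fun i => x i != 0) (enum I)).
    have xk : x k != 0 := nth_find i hs.
    exists k.
      apply/orP; right; apply/allP => l; rewrite memB /k.
      rewrite index_uniq ?enum_uniq -?has_find // => /(before_find i).
      by rewrite nth_index ?mem_enum // => /negbFE.
    apply: proper_card; apply/properP; split.
      apply/fintype.subsetP => l; rewrite !inE; case: (eqVneq k l) => [<-|kl].
        by rewrite upd_in eqxx.
      by rewrite upd_out.
    by exists k; rewrite !inE ?upd_in ?eqxx.
by apply/funext => -[].
Qed.

Lemma tf_rank_ge2 s : (2 <= s)%N ->
  (exists j, tf_rank j = s) <-> (exists i, n i = s).
Proof.
move=> s2; split=> [[[p|p] /= E]|[i <-]].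
- by exists (val p).1.
- by move: s2; rewrite -E; case: (tree _ _).
have h : rep i x0 == x0 by apply/eqP/rep_id; rewrite ffunE.
by exists (inl (exist (fun p : I * X => is_true (rep p.1 p.2 == p.2)) (i, x0) h)).
Qed.

(** An infinite factor together with another nontrivial one gives two infinite
    stabilizers.  If the nontrivial factors are finite, every point of [X] with
    two nonzero coordinates carries an edge outside the tree, and there are two
    such points because the free product is not [Z/2 * Z/2]. *)
Lemma tf_rank_two : nonelementary A ->
  exists j1 j2, [/\ j1 != j2, 0 < tf_rank j1 & 0 < tf_rank j2]%N.
Proof.
case=> -[i [j [ij Ai Aj]]] nD.
have vert i0 (x : X) : x i0 = 0 -> (0 < n i0)%N ->
    exists k, [/\ (0 < tf_rank k)%N & exists p, k = inl p /\ val p = (i0, x)].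
  move=> xi ni; have h : rep i0 x == x by apply/eqP/rep_id.
  exists (inl (exist (fun p : I * X => is_true (rep p.1 p.2 == p.2)) (i0, x) h)).
  by split=> //; eexists; split; first by reflexivity.
have nontriv l : ~ trivial_group (A l) -> (0 < n l)%N \/ exists t : T l, t != 0.
  move=> Al; have [a a0] : exists a : A l, a != 0.
    apply: contrapT => na; apply: Al => a; apply: contrapT => /eqP a0.
    by apply: na; exists a.
  case: (eqVneq (f l a).2 0) => [t0|]; last by right; exists (f l a).2.
  left; rewrite lt0n; apply/negP => /eqP nl; case/negP: a0; apply/eqP.
  rewrite -[LHS](fK (i := l)) (surjective_pairing (f l a)) t0 -[RHS](g0 l).
  by congr (g _); congr (_, _); apply/rowP => k; have := ltn_ord k; rewrite {2}nl.
have inf k l : k != l -> (0 < n k)%N -> ~ trivial_group (A l) ->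
    exists j1 j2, [/\ j1 != j2, 0 < tf_rank j1 & 0 < tf_rank j2]%N.
  move=> kl nk /nontriv tail_syl.
  have [j1 [r1 [p1 [e1 p1E]]]] := vert k x0 (ffunE _ _) nk; subst j1.
  case: tail_syl => [nl|[t t0]].
    have [j2 [r2 [p2 [e2 p2E]]]] := vert l x0 (ffunE _ _) nl; subst j2.
    exists (inl p1), (inl p2); split=> //.
    apply: contraNneq kl => -[] /(congr1 val).
    by rewrite p1E p2E => -[->].
  have [j2 [r2 [p2 [e2 p2E]]]] : exists j2, (0 < tf_rank j2)%N /\
      exists p, j2 = inl p /\ val p = (k, upd x0 t).
    have [|j2 [r2 h]] := vert k (upd x0 t) _ nk; last by exists j2.
    by rewrite upd_out ?ffunE // eq_sym.
  subst j2; exists (inl p1), (inl p2); split=> //.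
  apply: contraNneq t0 => -[] /(congr1 val).
  rewrite p1E p2E => -[] /(congr1 (fun y : X => y l)).
  by rewrite upd_in ffunE => <-.
have two (x y : X) k l : k != l -> x != y -> x k != 0 -> x l != 0 ->
    y k != 0 -> y l != 0 ->
    exists j1 j2, [/\ j1 != j2, 0 < tf_rank j1 & 0 < tf_rank j2]%N.
  move=> kl xy; wlog lt : k l kl / (index k (enum I) < index l (enum I))%N.
    move=> W xk xl yk yl.
    case: (ltngtP (index k (enum I)) (index l (enum I))) => [lt|lt|e].
    - exact: W lt _ _ _ _.
    - by apply: W lt _ _ _ _ => //; rewrite eq_sym.
    - have /eqP[] := kl; rewrite -(nth_index k (mem_enum I k)) e.
      by rewrite nth_index ?mem_enum.
  have nt (z : X) : z k != 0 -> z l != 0 -> ~~ tree l z.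
    move=> zk zl; rewrite /tree negb_or zl /=; apply/allPn; exists k => //.
    by rewrite memB.
  move=> xk xl yk yl; exists (inr (l, x)), (inr (l, y)).
  rewrite /= !nt //; split=> //.
  by apply: contraNneq xy => -[->].
have [ni|] := posnP (n i); last by move=> ni; apply: inf ni Aj; apply/eqP.
have [nj|] := posnP (n j); last first.
  by move=> nj; apply: inf nj Ai; apply/eqP => e; apply: ij.
have [|[ti ti0]] := nontriv i Ai; first by rewrite ni.
have [|[tj tj0]] := nontriv j Aj; first by rewrite nj.
have nij : i != j by apply/eqP.
have nji : j != i by rewrite eq_sym.
pose xx (t : T i) (t' : T j) : X := upd (upd x0 t) t'.
have xxi t t' : xx t t' i = t by rewrite /xx upd_out // upd_in.
have xxj t t' : xx t t' j = t' by rewrite /xx upd_in.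
case: (pselect (exists k, [/\ k != i, k != j & ~ trivial_group (A k)])) => [|others].
  case=> k [ki kj Ak]; have [nk|[tk tk0]] := nontriv k Ak; first exact: inf nk Ai.
  apply: (two (xx ti tj) (upd (xx ti tj) tk) i j nij); rewrite ?xxi ?xxj //.
  - apply: contraNneq tk0 => /(congr1 (fun y : X => y k)).
    by rewrite upd_in /xx !upd_out 1?eq_sym // ffunE => <-.
  - by rewrite upd_out ?xxi.
  - by rewrite upd_out ?xxj.
case: (pselect (exists t : T i, t != 0 /\ t != ti)) => [[t [t0 tti]]|oi].
  apply: (two (xx ti tj) (xx t tj) i j nij); rewrite ?xxi ?xxj //.
  apply: contraNneq tti => /(congr1 (fun y : X => y i)).
  by rewrite !xxi => ->.
case: (pselect (exists t : T j, t != 0 /\ t != tj)) => [[t [t0 ttj]]|oj].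
  apply: (two (xx ti tj) (xx ti t) i j nij); rewrite ?xxi ?xxj //.
  apply: contraNneq ttj => /(congr1 (fun y : X => y j)).
  by rewrite !xxj => ->.
have o2 k (t : T k) : n k = 0%N -> t != 0 -> ~ (exists u : T k, u != 0 /\ u != t) ->
    order_two (A k).
  move=> nk t0 nu; exists (g (0, t)).
    by move/(congr1 (@f k)); rewrite gK raddf0 => -[/eqP]; apply/negP.
  move=> y; have -> : y = g (0, (f k y).2).
    rewrite -[LHS](fK (i := k)) [in LHS](surjective_pairing (f k y)).
    by congr (g _); congr (_, _); apply/rowP => l; have := ltn_ord l; rewrite {2}nk.
  case: (eqVneq (f k y).2 0) => [->|y0]; first by left; apply: g0.
  right; congr (g _); congr (_, _); apply: contrapT => /eqP yt; apply: nu.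
  by exists (f k y).2.
case: nD; exists i, j; split=> //; [exact: o2 ti0 oi|exact: o2 tj0 oj|].
move=> k /eqP ki /eqP kj; apply: contrapT => Ak; apply: others.
by exists k.
Qed.

End TorsionFreeCover.

(** * Equal ranks imply commensurable *)

Lemma commensurable_ranks (I : finType) (A : I -> zmodType) (n : I -> nat) :
    nonelementary A -> (forall i, has_rank (A i) (n i)) ->
  exists L, [/\ commensurable (freeprod A) (lattice_prod L), (1 < size L)%N, all_pos L &
    forall s, (2 <= s)%N -> (s \in L) <-> exists i, n i = s].
Proof.
move=> nd hn.
pose T i := sval (cid (hn i)).
pose f i : {additive A i -> ('rV[int]_(n i) * T i)%type} := sval (cid (svalP (cid (hn i)))).
have fbij i : exists h, cancel (f i) h /\ cancel h (f i).
  by case: (svalP (cid (svalP (cid (hn i))))) => h fh hf; exists h.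
pose g i := sval (cid (fbij i)).
have fK i : cancel (f i) (g i) by case: (svalP (cid (fbij i))).
have gK i : cancel (g i) (f i) by case: (svalP (cid (fbij i))).
pose rho := @tf_rank I n T; exists [seq rho j | j <- enum (tf_idx T) & (0 < rho j)%N].
split.
- apply: commensurable_trans (commensurable_lattice_prod rho).
  by apply: commensurable_sym; apply: torsion_free_cover fK gK.
- have [j1 [j2 [j12 r1 r2]]] := tf_rank_two fK gK nd.
  rewrite size_map; apply: (@uniq_leq_size _ [:: j1; j2]).
    by rewrite /= inE j12.
  by move=> j; rewrite !inE mem_filter mem_enum => /orP[] /eqP ->; rewrite andbT.
- by apply/allP => s /mapP[j]; rewrite mem_filter => /andP[r0 _] ->.
- move=> s s2; rewrite -(@tf_rank_ge2 I n T s s2); split=> [/mapP[j _ ->]|[j js]].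
    by exists j.
  apply/mapP; exists j => //.
  by rewrite mem_filter mem_enum andbT (js : rho j = s); apply: ltnW.
Qed.

(** * Word length *)

Section WordLength.
Variables (G : groupType) (X : seq G).

Lemma is_word_nil : is_word X [::] 1%g.
Proof. by split; rewrite ?big_nil. Qed.

Lemma is_word_cat w1 w2 g1 g2 :
  is_word X w1 g1 -> is_word X w2 g2 -> is_word X (w1 ++ w2) (g1 * g2)%g.
Proof.
move=> [h1 <-] [h2 <-]; split; last by rewrite big_cat.
by move=> x; rewrite mem_cat => /orP[/h1|/h2].
Qed.

Lemma is_word_seq1 x : x \in X \/ (x^-1)%g \in X -> is_word X [:: x] x.
Proof. by move=> h; split; rewrite ?big_seq1 // => y; rewrite inE => /eqP ->. Qed.

Lemma is_word_inv w g : is_word X w g -> is_word X (rev [seq x^-1 | x <- w])%g (g^-1)%g.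
Proof.
case=> h <-; split.
  by move=> x; rewrite mem_rev => /mapP[y /h yX ->]; rewrite invgK; case: yX; [right|left].
elim: w {h} => [|x w IH]; first by rewrite !big_nil invg1.
by rewrite /= rev_cons -cats1 big_cat big_seq1 big_cons invgM /= IH.
Qed.

Hypothesis genX : generates X.

Lemma word_length_ex g :
  (exists2 w, is_word X w g & size w = word_length X g) /\
  forall w, is_word X w g -> (word_length X g <= size w)%N.
Proof.
apply: (@xgetPex _ 0%N [set k | (exists2 w, is_word X w g & size w = k) /\
                    forall w, is_word X w g -> (k <= size w)%N]).
have ex : exists k, `[< exists2 w, is_word X w g & size w = k >].
  by have [w wg] := genX g; exists (size w); apply/asboolP; exists w.
have [k /asboolP h kmin] := ex_minnP ex; exists k; split=> // w wg.
by apply: kmin; apply/asboolP; exists w.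
Qed.

Lemma word_length_le w g : is_word X w g -> (word_length X g <= size w)%N.
Proof. exact: (proj2 (word_length_ex g)). Qed.

Lemma word_lengthM g h :
  (word_length X (g * h)%g <= word_length X g + word_length X h)%N.
Proof.
have [[w1 h1 <-] _] := word_length_ex g; have [[w2 h2 <-] _] := word_length_ex h.
by rewrite -size_cat; apply: word_length_le; apply: is_word_cat.
Qed.

Lemma word_lengthV g : (word_length X (g^-1)%g <= word_length X g)%N.
Proof.
have [[w h <-] _] := word_length_ex g.
by apply: leq_trans (word_length_le (is_word_inv h)) _; rewrite size_rev size_map.
Qed.

Lemma word_length_bounded (s : seq G) :
  exists N, {in s, forall g, (word_length X g <= N)%N}.
Proof.
exists (\max_(g <- s) word_length X g)%N => g gs.
by apply: (@leq_bigmax_seq _ s predT (word_length X) g gs).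
Qed.

Lemma word_ball_finite N :
  exists s : seq G, forall g, (word_length X g <= N)%N -> g \in s.
Proof.
pose Y := X ++ [seq x^-1 | x <- X]%g.
suff [s sE] : exists s : seq G, forall w g, is_word X w g -> (size w <= N)%N -> g \in s.
  exists s => g gN; have [[w wg wE] _] := word_length_ex g.
  by apply: sE wg _; rewrite wE.
elim: N => [|N [s IH]].
  exists [:: 1%g] => -[|//] g [_ <-] _; by rewrite big_nil inE.
exists (1%g :: [seq (x * g)%g | x <- Y, g <- s]) => -[|x w] g [h <-].
  by rewrite big_nil inE eqxx.
rewrite ltnS => wN; rewrite inE big_cons; apply/orP; right.
apply/allpairsP; exists (x, (\prod_(x <- w) x)%g); split=> //=.
  rewrite /Y mem_cat; have [->//|xX] := h x (mem_head _ _).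
  by apply/orP; right; apply/mapP; exists (x^-1)%g; rewrite ?invgK.
by apply: IH wN; split=> // y yw; apply: h; rewrite inE yw orbT.
Qed.

End WordLength.

Lemma free_product_fg (I : finType) (A : I -> zmodType) (G : groupType)
    (iota : forall i, A i -> G) :
    (forall i, fg_abelian (A i)) -> is_free_product iota ->
  exists X : seq G, generates X.
Proof.
move=> fgA hG; pose s i := sval (cid (fgA i)).
have sE i : forall a : A i, exists c : 'I_(size (s i)) -> int,
    a = \sum_(k < size (s i)) (s i)`_k *~ c k := svalP (cid (fgA i)).
have [f [g [[_ gM fK _] _ gE]]] := free_normal_form hG.
pose X := flatten [seq [seq iota i x | x <- s i] | i <- enum I].
exists X => z; rewrite -(fK z) [f z]freeprod_word.
pose W z := exists w, is_word X w z.
have WM x y : W x -> W y -> W (x * y)%g.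
  by move=> [w1 h1] [w2 h2]; exists (w1 ++ w2); apply: is_word_cat.
have WV x : W x -> W (x^-1)%g.
  by move=> [w h]; exists (rev [seq x^-1 | x <- w])%g; apply: is_word_inv.
have W1 : W 1%g by exists [::]; apply: is_word_nil.
have iD := proj1 hG.
elim: (val (f z)) => [|[i a] w IH]; first by rewrite big_nil ghom1.
rewrite big_cons gM; apply: (WM _ _ _ IH); rewrite /fsyl /= gE.
have [c ->] := sE i a.
elim/big_ind: _ => [|x y hx hy|k _]; first by rewrite (zhom0 (iD i)).
  by rewrite iD; apply: WM.
rewrite (zhomZ _ _ (iD i)); set h := iota i _.
have Wk : W h.
  eexists; apply: is_word_seq1; left; apply/flatten_mapP; exists i.
    by rewrite mem_enum.
  by apply: map_f; apply: mem_nth.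
have WX m : W (h ^+ m)%g.
  by elim: m => [|m IHm]; [rewrite expg0|rewrite expgS; apply: WM].
by case: (c k) => m /=; [apply: WX|apply: WV; apply: WX].
Qed.

(** * Commensurable groups are quasi-isometric *)

(** Schreier's argument: [x * c x] is a point of [H1] close to [x], and a step
    by a generator moves it by one of finitely many elements of [H1]. *)
Lemma coset_map_lipschitz (G1 G2 : groupType) (X1 : seq G1) (X2 : seq G2)
    (H1 : set G1) (f : G1 -> G2) (s : seq G1) (c : G1 -> G1) :
    generates X1 -> generates X2 -> is_subgroup H1 ->
    (forall x y, H1 x -> H1 y -> f (x * y)%g = (f x * f y)%g) ->
    (forall x, c x \in s /\ H1 (x * c x)%g) ->
  exists L, forall x y,
    (word_length X2 ((f (x * c x))^-1 * f (y * c y))%g <=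
     L * word_length X1 (x^-1 * y)%g)%N.
Proof.
move=> gX1 gX2 [H11 HM HV] fM cP.
have f1 : f 1%g = 1%g by apply: (@mulgI _ (f 1%g)); rewrite -fM // !mulg1.
have fV x : H1 x -> f (x^-1)%g = (f x)^-1%g.
  by move=> xH; apply/esym/mulg1_eq; rewrite -fM ?mulgV //; apply: HV.
pose Y := X1 ++ [seq x^-1 | x <- X1]%g.
(* all steps of the image path lie in this finite set *)
pose S := [seq f (a^-1 * r)%g | a <- s, r <- [seq (t * b)%g | t <- Y, b <- s]].
have [L LE] := word_length_bounded X2 S.
exists L => x y; have [[w wE <-] _] := word_length_ex gX1 (x^-1 * y)%g.
have -> : y = (x * (x^-1 * y))%g by rewrite mulVKg.
case: wE => wX <-; elim: w x wX => [|t w IH] x wX.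
  rewrite big_nil mulg1 mulVg.
  by apply: leq_trans (word_length_le gX2 (is_word_nil X2)) _.
rewrite big_cons mulgA mulnS.
set z := (x * t * _)%g.
rewrite -(mulVKg (f (x * t * c (x * t)))%g (f (z * c z))%g) mulgA.
apply: leq_trans (word_lengthM gX2 _ _) _; apply: leq_add; last first.
  by apply: IH => u uw; apply: wX; rewrite inE uw orbT.
apply: LE; have [cx xH] := cP x; have [cxt xtH] := cP (x * t)%g.
rewrite -fV // -fM //; last exact: HV.
apply/allpairsP; exists (c x, t * c (x * t))%g; split=> //=; last first.
  by rewrite invgM -!mulgA mulKg.
apply/allpairsP; exists (t, c (x * t))%g; split=> //=.
rewrite /Y mem_cat; have [->//|tX] := wX t (mem_head _ _).
by apply/orP; right; apply/mapP; exists (t^-1)%g; rewrite ?invgK.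
Qed.

Lemma coset_map_ex (G : groupType) (H : set G) : fi_subgroup H ->
  exists (s : seq G) (c : G -> G), forall x, c x \in s /\ H (x * c x)%g.
Proof.
case=> [[_ _ HV] [s sE]].
have ex x : exists c, c \in s /\ H (x * c)%g.
  have [c cs cH] := sE (x^-1)%g; exists c; split=> //.
  by have := HV _ cH; rewrite invgM !invgK.
by have [c cE] := choice ex; exists s, c.
Qed.

Lemma coset_map_quasi_inverse (G1 G2 : groupType) (X1 : seq G1)
    (H1 : set G1) (H2 : set G2) (f : G1 -> G2) (g : G2 -> G1)
    (s1 : seq G1) (s2 : seq G2) (c1 : G1 -> G1) (c2 : G2 -> G2) :
    generates X1 -> is_subgroup H2 -> partial_isom H1 H2 f g ->
    (forall x y, H2 x -> H2 y -> g (x * y)%g = (g x * g y)%g) ->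
    (forall x, c1 x \in s1 /\ H1 (x * c1 x)%g) ->
    (forall y, c2 y \in s2 /\ H2 (y * c2 y)%g) ->
  exists D, forall x,
    (word_length X1 (x^-1 * g (f (x * c1 x) * c2 (f (x * c1 x))))%g <= D)%N.
Proof.
move=> gX1 [_ HM HV] [fE gE fM] gM c1P c2P.
have [D DE] := word_length_bounded X1 [seq (a * g b)%g | a <- s1, b <- s2].
exists D => x; have [c1s c1H] := c1P x.
have [fH gfE] := fE _ c1H; set y := f _ in fH gfE *.
have [c2s c2H] := c2P y.
have cH : H2 (c2 y) by rewrite -[c2 y](mulKg y); apply: HM => //; apply: HV.
rewrite gM // gfE !mulgA mulVg mul1g; apply: DE.
by apply/allpairsP; exists (c1 x, c2 y).
Qed.

Lemma commensurable_quasi_isometric (R : realType) (G1 G2 : groupType)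
    (X1 : seq G1) (X2 : seq G2) :
  generates X1 -> generates X2 -> commensurable G1 G2 -> quasi_isometric R G1 G2.
Proof.
move=> gX1 gX2 /commensurableP[H1 [H2 [f [g [h1 h2 p]]]]].
have p' := partial_isom_sym (proj1 h1) p.
have [s1 [c1 c1P]] := coset_map_ex h1; have [s2 [c2 c2P]] := coset_map_ex h2.
have fM : forall x y, H1 x -> H1 y -> f (x * y)%g = (f x * f y)%g by case: p.
have gM : forall x y, H2 x -> H2 y -> g (x * y)%g = (g x * g y)%g by case: p'.
have [L FL] := coset_map_lipschitz gX1 gX2 (proj1 h1) fM c1P.
have [L' F'L] := coset_map_lipschitz gX2 gX1 (proj1 h2) gM c2P.
have [D DE] := coset_map_quasi_inverse gX1 (proj1 h2) p gM c1P c2P.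
have [D' D'E] := coset_map_quasi_inverse gX2 (proj1 h1) p' fM c2P c1P.
pose F x := f (x * c1 x)%g; pose F' y := g (y * c2 y)%g.
have low x y : (word_length X1 (x^-1 * y)%g <=
    L' * word_length X2 ((F x)^-1 * F y)%g + 2 * D)%N.
  have -> : (x^-1 * y = x^-1 * F' (F x) * ((F' (F x))^-1 * F' (F y)) *
      (y^-1 * F' (F y))^-1)%g.
    by rewrite invgM invgK !mulgA !mulgK.
  apply: leq_trans (word_lengthM gX1 _ _) _.
  rewrite mul2n -addnn addnA; apply: leq_add; last first.
    by apply: leq_trans (word_lengthV gX1 _) _.
  apply: leq_trans (word_lengthM gX1 _ _) _.
  by rewrite addnC; apply: leq_add; [exact: F'L|exact: DE].
exists X1, X2; split=> //.
exists F, (L + L' + 1)%N%:R, (2 * D + D')%N%:R; split.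
- by rewrite ler1n addn1.
- exact: ler0n.
- move=> x y; rewrite /word_dist; set d1 := word_length _ _; set d2 := word_length _ _.
  apply/andP; split; last first.
    rewrite -natrM -natrD ler_nat; apply: leq_trans (FL x y) _.
    by rewrite -/d1 !mulnDl; lia.
  rewrite lerBlDr ler_pdivrMl ?ltr0n ?addn1 // -natrD -natrM ler_nat.
  by apply: leq_trans (low x y) _; rewrite -/d2; nia.
- move=> z; exists (F' z); rewrite /word_dist ler_nat.
  apply: leq_trans (leq_addl _ _); rewrite -(invgK z) -invgM.
  apply: leq_trans (word_lengthV gX2 _) _.
  by rewrite invgK; apply: D'E.
Qed.

(** * Coarse geometry of the lattice [Z^n] *)

Section Lattice.
Variable n : nat.
Implicit Types (y z c v : 'rV[int]_n) (r : nat).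

Definition near r v := [forall k, `|v 0%R k|%N <= r]%N.
Definition far r v := ~~ near r v.

Lemma farP r v : reflect (exists k, r < `|v 0%R k|)%N (far r v).
Proof.
rewrite /far /near negb_forall; apply: (iffP existsP) => -[k h]; exists k;
  by rewrite ltnNge in h *.
Qed.

Lemma nearP r v : reflect (forall k, `|v 0%R k| <= r)%N (near r v).
Proof. exact: forallP. Qed.

Lemma nearN r v : near r (- v) = near r v.
Proof. by apply: eq_forallb => k; rewrite mxE abszN. Qed.

Lemma nearD r r' v v' : near r v -> near r' v' -> near (r + r') (v + v').
Proof.
move=> /nearP h /nearP h'; apply/nearP => k; rewrite mxE.
move: (h k) (h' k) => hk hk'; apply: leq_trans (leq_add hk hk').
by move: (v _ _) (v' _ _) => a b; lia.
Qed.

Lemma near_le r r' v : (r <= r')%N -> near r v -> near r' v.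
Proof. by move=> rr' /nearP h; apply/nearP => k; apply: leq_trans (h k) rr'. Qed.

Definition unit k : 'rV[int]_n := delta_mx 0%R k.

Lemma unitE k l : unit k 0%R l = (l == k)%:R.
Proof. by rewrite mxE. Qed.

Lemma near_unit k : near 1 (unit k).
Proof. by apply/nearP => l; rewrite unitE; case: eqP. Qed.

Definition norm1 v := (\sum_k `|v 0%R k|)%N.

Lemma norm1_near v : near (norm1 v) v.
Proof. by apply/nearP => k; rewrite /norm1 (bigD1 k) //= leq_addr. Qed.

Lemma near_bounded (s : seq 'rV[int]_n) : exists r, {in s, forall v, near r v}.
Proof.
exists (\max_(v <- s) norm1 v)%N => v vs; apply: near_le (norm1_near v).
exact: (@leq_bigmax_seq _ s predT norm1 v vs).
Qed.

Lemma near_finite r : exists s : seq 'rV[int]_n, forall v, near r v -> v \in s.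
Proof.
exists [seq \row_k ((x 0%R k : nat)%:Z - r%:Z) | x : 'rV['I_(r + r).+1]_n] => v /nearP h.
apply/mapP; exists (\row_k inord (absz (v 0%R k + r%:Z))); first by rewrite mem_enum.
by apply/rowP => k; rewrite !mxE inordK; move: (h k); move: (v _ _) => a; lia.
Qed.

Lemma step_towards y0 y : y != y0 -> exists k y',
  [/\ y 0%R k != y0 0%R k, norm1 (y - y0) = (norm1 (y' - y0)).+1 &
      y' = y + unit k \/ y = y' + unit k].
Proof.
move=> yy0; have [k yk] : exists k, y 0%R k != y0 0%R k.
  apply/existsP; apply: contraNT yy0 => /existsPn h; apply/eqP/rowP => k.
  by apply/eqP; have := h k; rewrite negbK.
have red y' : (forall l, l != k -> y' 0%R l = y 0%R l) ->
    `|y 0%R k - y0 0%R k|%N = `|y' 0%R k - y0 0%R k|.+1%N ->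
    norm1 (y - y0) = (norm1 (y' - y0)).+1.
  move=> hl hk; rewrite /norm1 (bigD1 k) //= [in RHS](bigD1 k) //= !mxE hk addSn.
  by congr (_ + _).+1; apply: eq_bigr => l lk; rewrite !mxE hl.
have := yk; case: (ltrgtP (y 0%R k) (y0 0%R k)) => // lt _.
  exists k, (y + unit k); split=> //; last by left.
  apply: red => [l /negPf lk|]; rewrite mxE unitE ?lk ?addr0 // eqxx.
  by move: (y _ _) (y0 _ _) lt => a b; lia.
exists k, (y - unit k); split=> //; last by right; rewrite subrK.
apply: red => [l /negPf lk|]; rewrite !mxE ?eqxx ?lk ?subr0 //=.
by move: (y _ _) (y0 _ _) lt => a b; lia.
Qed.

(** Induction on the distance to [y0], changing only coordinates outside [K]. *)
Lemma walk (K : {pred 'I_n}) (Q : 'rV[int]_n -> Prop) y0 :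
    (forall y l, l \notin K -> (forall k, k \in K -> y 0%R k = y0 0%R k) ->
       (Q y <-> Q (y + unit l))) ->
  forall y, (forall k, k \in K -> y 0%R k = y0 0%R k) -> (Q y <-> Q y0).
Proof.
move=> inv y; have [N] := ubnP (norm1 (y - y0)); elim: N y => // N IH y lt yK.
case: (eqVneq y y0) => [->//|/step_towards[k [y' [yk E yy']]]].
have kK : k \notin K by apply: contraNN yk => /yK ->.
have y'K : forall l, l \in K -> y' 0%R l = y0 0%R l.
  move=> l lK; have lk : l == k = false.
    by apply/negbTE; apply: contraNneq kK => <-.
  case: yy' => [->|yE]; first by rewrite mxE unitE lk addr0 yK.
  by rewrite -yK // yE mxE unitE lk addr0.
have <- : Q y' <-> Q y0 by apply: IH => //; rewrite E in lt.
by case: yy' => e; [rewrite e; apply: inv|rewrite {1}e; symmetry; apply: inv].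
Qed.

(** For [n >= 2] the complement of a box is connected by unit steps: one can
    always move while keeping one coordinate out of the box. *)
Lemma complement_connected (Q : 'rV[int]_n -> Prop) D c : (2 <= n)%N ->
    (forall y l, far D (y - c) -> far D (y + unit l - c) -> (Q y <-> Q (y + unit l))) ->
  forall y z, far D (y - c) -> far D (z - c) -> (Q y <-> Q z).
Proof.
move=> n2 inv.
pose out y k := (D < `|y 0%R k - c 0%R k|)%N.
have outP y k : out y k -> far D (y - c).
  by move=> h; apply/farP; exists k; rewrite !mxE.
have slide k y z : out y k -> y 0%R k = z 0%R k -> (Q y <-> Q z).
  move=> oy yz; apply: (walk (K := pred1 k)) => [x l lk xk|l]; last first.
    by rewrite inE => /eqP ->.
  have ox : x 0%R k = y 0%R k by rewrite yz xk ?inE.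
  apply: inv; first by apply: (outP _ k); rewrite /out ox.
  apply: (outP _ k); rewrite /out mxE unitE ox.
  by rewrite inE eq_sym in lk; rewrite (negPf lk) addr0.
pose set y k a : 'rV[int]_n := \row_l (if l == k then a else y 0%R l).
have cross k l y z : k != l -> out y k -> out z l -> (Q y <-> Q z).
  move=> kl oy oz; pose w := set z k (y 0%R k).
  have wk : w 0%R k = y 0%R k by rewrite mxE eqxx.
  have wl : w 0%R l = z 0%R l by rewrite mxE eq_sym (negPf kl).
  rewrite (slide k y w oy (esym wk)); symmetry.
  exact: (slide l z w oz (esym wl)).
move=> y z /farP[k yk] /farP[l zl].
have {}yk : out y k by rewrite !mxE in yk.
have {}zl : out z l by rewrite !mxE in zl.
case: (eqVneq k l) => [kl|/cross h]; last exact: h.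
subst l; have [l lk] : exists l : 'I_n, l != k.
  case: n n2 k {inv out outP slide set cross y z yk zl Q c} => [|[|m]] // _ k.
  by exists (lift k ord0); rewrite eq_sym neq_lift.
pose w := set y l (c 0%R l + D.+1%:Z).
have wk : w 0%R k = y 0%R k by rewrite mxE eq_sym (negPf lk).
rewrite (slide k y w yk (esym wk)); apply: cross lk _ zl.
by rewrite /out mxE eqxx; lia.
Qed.

Lemma far_axis (r : nat) (h : (0 < n)%N) a : (r < a)%N -> far r (axis n a%:Z).
Proof. by move=> ra; apply/farP; exists (Ordinal h); rewrite mxE /=. Qed.

Lemma far_shift (r : nat) c y : far (r + norm1 c) y -> far r (y - c).
Proof.
apply: contraNN => h; rewrite -(subrK c y).
exact: nearD h (norm1_near c).
Qed.

End Lattice.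

(** * Growth *)

(** The box of side [M] in the lattice of [r+1]-multiples has [(M+1)^n] points,
    and its image lies in a box of side linear in [M]. *)
Lemma lattice_growth (n m : nat) (T : finType)
    (psi : 'rV[int]_n -> 'rV[int]_m * T) (L r : nat) :
    (forall y l, near L ((psi (y + unit l)).1 - (psi y).1)) ->
    (forall y y', psi y = psi y' -> near r (y - y')) ->
  (n <= m)%N.
Proof.
move=> lip inj; rewrite leqNgt; apply/negP => mn.
have lipN y : near (L * norm1 (y - 0)) ((psi y).1 - (psi 0).1).
  have [N] := ubnP (norm1 (y - 0)); elim: N y => // N IH y lt.
  case: (eqVneq y 0) => [->|/step_towards[k [y' [_ E yy']]]].
    by rewrite !subrr; apply/nearP => k; rewrite mxE.
  rewrite E in lt *; rewrite mulnS -(subrKA (psi y').1).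
  apply: nearD; last exact: IH.
  by case: yy' => ->; rewrite // -nearN opprB.
pose K := (L * (n * r.+1))%N.
have count M : (M.+1 ^ n <= ((K + K).+1 * M.+1) ^ m * #|T|)%N.
  pose B := (K * M)%N.
  pose pt (x : 'rV['I_M.+1]_n) : 'rV[int]_n := \row_k ((x 0%R k : nat) * r.+1)%N%:Z.
  have ptB x : near B ((psi (pt x)).1 - (psi 0).1).
    apply: near_le (lipN _); rewrite /B /K subr0 -mulnA leq_mul2l; apply/orP; right.
    rewrite -[n in (_ <= n * _ * _)%N]card_ord -mulnA -sum_nat_const.
    apply: leq_sum => k _; rewrite mxE absz_nat mulnC leq_mul2l.
    by rewrite -ltnS ltn_ord orbT.
  pose F x : 'rV['I_(B + B).+1]_m * T :=
    (\row_k inord (absz ((psi (pt x)).1 0%R k - (psi 0).1 0%R k + B%:Z)), (psi (pt x)).2).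
  have FI : injective F.
    move=> x x' [/rowP E1 E2].
    have /inj/nearP h : psi (pt x) = psi (pt x').
      rewrite [LHS]surjective_pairing [RHS]surjective_pairing E2; congr (_, _).
      apply/rowP => k; have := E1 k; rewrite !mxE => /(congr1 val) /=.
      have /nearP/(_ k) := ptB x; have /nearP/(_ k) := ptB x'; rewrite !mxE.
      move: ((psi (pt x)).1 _ k) ((psi (pt x')).1 _ k) ((psi 0).1 _ k) => p q o b b'.
      by rewrite !inordK; lia.
    apply/rowP => k; apply/val_inj => /=; have := h k; rewrite !mxE.
    by move: (val (x 0%R k)) (val (x' 0%R k)) => p q; nia.
  have := leq_card F FI; rewrite card_prod !card_mx !card_ord !mul1n.
  move=> le; apply: leq_trans le _; rewrite leq_mul2r; apply/orP; right.
  by have [->//|m0] := posnP m; rewrite leq_exp2r // /B; nia.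
have := count (((K + K).+1 ^ m) * #|T|)%N; set M := (_ * _)%N.
apply/negP; rewrite -ltnNge expnMn.
apply: (@leq_trans (M.+1 ^ m.+1)); last exact: leq_pexp2l.
by rewrite mulnAC -/M expnS ltn_mul2r ltnSn expn_gt0.
Qed.

Lemma rank_le (V : zmodType) n m : has_rank V n -> has_rank V m -> (n <= m)%N.
Proof.
case=> T [f [g fK gK]] [S [h [k hK kK]]].
have gD : {morph g : a b / a + b} by move=> a b; apply: (can_inj fK); rewrite raddfD !gK.
pose psi (y : 'rV[int]_n) := h (g (y, 0)).
have psiD y z : psi (y + z) = psi y + psi z.
  by rewrite /psi -raddfD -gD; congr (h (g _)); congr (_, _); rewrite addr0.
apply: (@lattice_growth n m S psi (\max_l norm1 (psi (unit l)).1) 0).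
  move=> y l; have -> : (psi (y + unit l)).1 - (psi y).1 = (psi (unit l)).1.
    by rewrite psiD /= addrC addKr.
  apply: near_le (norm1_near _).
  exact: (@leq_bigmax _ (fun l => norm1 (psi (unit l)).1) l).
move=> y y' /(can_inj hK) /(can_inj gK) [->].
by apply/nearP => l; rewrite subrr mxE.
Qed.

Lemma rank_unique (V : zmodType) n m : has_rank V n -> has_rank V m -> n = m.
Proof. by move=> h h'; apply/eqP; rewrite eqn_leq !(rank_le h, rank_le h'). Qed.

(** * Cut points in a free product *)

Section CutPoints.
Variables (I : finType) (A : I -> zmodType).
Implicit Types (s t : seq (syllable A)) (u v w : freeprod A).

Lemma head_syl_mulg_finj i k (b : A k) s : reduced s -> s <> cons_syl (head_syl i s) [::] ->
  head_syl i (val (word_act (@factor_act _ A) s (finj b))) = head_syl i s.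
Proof.
elim: s i => [|[j a] s IH] i rs ne; first by case: ne; rewrite /cons_syl eqxx.
rewrite -/(syl a) in rs ne *; move: rs; rewrite reduced_cons => /and3P[a0 js rs].
rewrite [word_act _ _ _]/=; set w := word_act _ s _; rewrite [val _]/= /act.
case: (eqVneq s [::]) => [s0|s0]; last first.
  have -> : head_syl j (val w) = 0.
    rewrite IH ?head_syl_avoids // /cons_syl eqxx; exact/eqP.
  by rewrite addr0 /cons_syl (negPf a0).
have ij : j != i.
  apply: contra_not_neq ne => ji; subst i.
  by rewrite head_syl_cons /cons_syl (negPf a0) s0.
rewrite [RHS]head_syl_avoids // {}/w s0 [val _]val_finj /=.
case: (eqVneq (a + head_syl j (cons_syl b [::])) 0) => [c0|c0]; last first.
  by rewrite /cons_syl (negPf c0) head_syl_avoids.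
rewrite /cons_syl c0 eqxx; case: (eqVneq k j) => [kj|kj].
  by subst k; rewrite tail_syl_cons_syl.
have kb : avoids j (cons_syl b [::]) by rewrite /cons_syl; case: ifP.
by rewrite head_syl_avoids // addr0 in c0; rewrite c0 eqxx in a0.
Qed.

(** A path that changes its projection to the factor [A i] must pass through
    the projection point: each point of [A i] carries a branch of the free
    product that is attached to [A i] only there. *)
Lemma fp_exit i s u :
    head_syl i (val (u * \prod_(x <- s) fsyl x)%g) <> head_syl i (val u) ->
  exists2 k, (k <= size s)%N &
    (u * \prod_(x <- take k s) fsyl x)%g = finj (head_syl i (val u)).
Proof.
elim: s u => [|x s IH] u; first by rewrite big_nil mulg1.
rewrite big_cons mulgA => ne.
case: (pselect (head_syl i (val (u * fsyl x)%g) = head_syl i (val u))) => [e|ne'].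
  have [|k ks kE] := IH (u * fsyl x)%g; first by rewrite e.
  by exists k.+1; rewrite //= big_cons mulgA kE e.
exists 0%N; rewrite // take0 big_nil mulg1.
case: (pselect (val u = cons_syl (head_syl i (val u)) [::])) => [e|ne2].
  by apply: val_inj; rewrite val_finj; exact: e.
by case: ne'; rewrite -[in RHS](head_syl_mulg_finj (tagged x) (valP u) ne2).
Qed.

Definition prefixes s : seq (freeprod A) :=
  [seq (\prod_(x <- take k s) fsyl x)%g | k <- iota 0 (size s).+1].

Lemma fp_exit_prefix i u v : head_syl i (val (u * v)%g) <> head_syl i (val u) ->
  exists2 q, q \in prefixes (val v) & (u * q)%g = finj (head_syl i (val u)).
Proof.
rewrite {1}(freeprod_word v) => /fp_exit[k ks kE].
exists (\prod_(x <- take k (val v)) fsyl x)%g => //.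
by apply: map_f; rewrite mem_iota.
Qed.

Lemma reduced_catl s t : reduced (s ++ t) -> reduced s.
Proof.
rewrite /reduced all_cat => /andP[/andP[-> _]] /cat_sorted2[-> _].
by [].
Qed.

Lemma reduced_catr s t : reduced (s ++ t) -> reduced t.
Proof.
rewrite /reduced all_cat => /andP[/andP[_ ->]] /cat_sorted2[_ ->].
by [].
Qed.

Lemma reduced_glue s (x : syllable A) t :
  reduced (rcons s x) -> reduced (x :: t) -> reduced (s ++ x :: t).
Proof.
elim: s => //= y s IH; case: y => i a; rewrite -!/(syl a) !reduced_cons.
move=> /and3P[-> iNs rs] rt; rewrite (IH rs rt) andbT /=.
by case: s iNs {IH rs}.
Qed.

Lemma val_mulg_cat u v s t : val u = s -> val v = t -> reduced (s ++ t) ->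
  val (u * v)%g = s ++ t.
Proof.
move=> us <- {t}; rewrite val_mulg us => {us}; elim: s => //= x s IH r.
by rewrite IH ?act_cons //; apply: reduced_behead r.
Qed.

End CutPoints.

(** * Coarse maps *)

Definition bornologous (G1 G2 : groupType) (f : G1 -> G2) :=
  forall F : seq G1, exists F' : seq G2,
    forall x y, (x^-1 * y)%g \in F -> ((f x)^-1 * f y)%g \in F'.

Definition lattice_bornologous n (G : groupType) (f : 'rV[int]_n -> G) :=
  forall r, exists F : seq G,
    forall y z, near r (z - y) -> ((f y)^-1 * f z)%g \in F.

Definition lattice_proper n (G : groupType) (f : 'rV[int]_n -> G) :=
  forall F : seq G, exists r,
    forall y z, ((f y)^-1 * f z)%g \in F -> near r (z - y).

Section LatticeInFreeProduct.
Variables (I : finType) (A : I -> zmodType) (n : nat).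
Hypothesis n2 : (2 <= n)%N.
Variable f : 'rV[int]_n -> freeprod A.
Hypothesis fb : lattice_bornologous f.
Hypothesis fp : lattice_proper f.

Let n0 : (0 < n)%N := ltnW n2.

(** The fibre over [g a] of the nearest-point projection to the coset [g A_i],
    pulled back to the lattice. *)
Definition over (g : freeprod A) i (a : A i) (y : 'rV[int]_n) :=
  head_syl i (val (g^-1 * f y)%g) = a.

(** By [fp_exit], the path from [f y] to [f z] must go through [g a]. *)
Lemma over_frontier : exists Q : seq (freeprod A), forall g i (a : A i) y z,
    near 1 (z - y) -> over g a y -> ~ over g a z ->
  exists2 q, q \in Q & f y = (g * finj a * q^-1)%g.
Proof.
have [F FE] := fb 1; exists (flatten [seq prefixes (val v) | v <- F]).
move=> g i a y z yz ya za.
have E : (g^-1 * f z = g^-1 * f y * ((f y)^-1 * f z))%g by rewrite mulgA mulgK.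
have [|q qv qE] := @fp_exit_prefix _ A i (g^-1 * f y)%g ((f y)^-1 * f z)%g.
  by rewrite -E ya.
exists q; first by apply/flatten_mapP; exists ((f y)^-1 * f z)%g => //; apply: FE.
by rewrite -mulgA -ya -qE mulgK mulVKg.
Qed.

(** The frontier of a fibre lies in a box of uniform size, since it maps close to
    one point; outside that box the fibre is everything or nothing. *)
Lemma over_dichotomy : exists D, forall g i (a : A i),
  exists c, (forall y, far D (y - c) -> over g a y) \/
            (forall y, far D (y - c) -> ~ over g a y).
Proof.
have [Q QE] := over_frontier.
have [D DE] := fp [seq (q * q'^-1)%g | q <- Q, q' <- Q].
exists D => g i a.
pose E y := exists2 q, q \in Q & f y = (g * finj a * q^-1)%g.
have EE y z : E y -> E z -> near D (z - y).
  move=> [q qQ yE] [q' q'Q zE]; apply: DE; rewrite yE zE.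
  rewrite !invgM !invgK !mulgA !mulgVK.
  by apply/allpairsP; exists (q, q').
have [c cE] : exists c, forall y, E y -> near D (y - c).
  case: (pselect (exists c, E c)) => [[c Ec]|nE].
    by exists c => y; apply: EE.
  by exists 0 => y Ey; case: nE; exists y.
have inv y l : far D (y - c) -> far D (y + unit l - c) ->
    (over g a y <-> over g a (y + unit l)).
  move=> fy lattice_prod; split=> h; apply: contrapT => nh.
    have : near 1 (y + unit l - y) by rewrite addrC addKr near_unit.
    by move=> /QE/(_ h nh)/cE; apply/negP.
  have : near 1 (y - (y + unit l)) by rewrite opprD addNKr nearN near_unit.
  by move=> /QE/(_ h nh)/cE; apply/negP.
have conn := complement_connected n2 inv.
exists c; case: (pselect (exists y, far D (y - c) /\ over g a y)) => [[y [fy oy]]|no].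
  by left=> z lattice_prod; apply/(conn _ _ fy lattice_prod).
by right=> z lattice_prod oz; apply: no; exists z.
Qed.

(** If every fibre over [g A_i] is bounded, each fibre contains a frontier
    point, and the whole image is close to [g A_i]. *)
Lemma near_coset D (g : freeprod A) i :
    (forall a : A i, exists c, forall y, far D (y - c) -> ~ over g a y) ->
  exists F : seq (freeprod A), forall y, exists a : A i,
    ((finj a)^-1 * (g^-1 * f y))%g \in F.
Proof.
move=> bnd; have [Q QE] := over_frontier; have [F FE] := fb (D + D).
exists [seq (q^-1 * b)%g | q <- Q, b <- F] => y.
pose a := head_syl i (val (g^-1 * f y)%g); exists a.
have [c cE] := bnd a.
have nearc z : over g a z -> near D (z - c).
  by move=> oz; apply: contraT => /cE /(_ oz).
have oy : over g a y by [].
have [z [oz [q qQ zE]]] : exists z, over g a z /\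
    exists2 q, q \in Q & f z = (g * finj a * q^-1)%g.
  apply: contrapT => nz.
  have inv z l : over g a z <-> over g a (z + unit l).
    split=> h; apply: contrapT => nh; apply: nz.
      exists z; split=> //; apply: QE h nh.
      by rewrite addrC addKr near_unit.
    exists (z + unit l); split=> //; apply: QE h nh.
    by rewrite opprD addNKr nearN near_unit.
  pose z := c + axis n D.+1%:Z.
  apply: (cE z); first by rewrite /z addrC addKr; apply: far_axis.
  by apply/(@walk n pred0 (over g a) y).
have zy : near (D + D) (y - z).
  have -> : y - z = (y - c) - (z - c) by rewrite opprB addrA subrK.
  by apply: nearD; rewrite ?nearN; apply: nearc.
have := FE _ _ zy; set b := (_ * _)%g => bF.
apply/allpairsP; exists (q, b); split=> //=.
by rewrite /b zE !invgM invgK !mulgA mulVg mul1g.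
Qed.

Let far_pt r c : exists N, forall M, (N <= M)%N -> far r (axis n M%:Z - c).
Proof.
exists (r + norm1 c).+1 => M NM.
by apply: far_shift; apply: far_axis.
Qed.

(** Otherwise every coset [g A_i] has a fibre with bounded complement.  These
    point towards an end of the tree of cosets: starting from [f 0], one finds
    ever longer words [w] such that almost all [f y] lie behind [f 0 * w].
    The exceptional set has a diameter that does not depend on [w], so that a
    fixed [f y1] would be arbitrarily far from [f 0]. *)
Lemma no_escape D :
  ~ (forall g i, exists (a : A i) c, forall y, far D (y - c) -> over g a y).
Proof.
move=> cob; pose h y := ((f 0)^-1 * f y)%g.
pose behind (w : freeprod A) y := prefix (val w) (val (h y)).
have step (w : freeprod A) : (exists c, forall y, far D (y - c) -> behind w y) ->
    exists w' : freeprod A, size (val w') = (size (val w)).+1 /\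
      exists c, forall y, far D (y - c) -> behind w' y.
  move=> [c cE]; pose g := (f 0 * w)%g.
  have hw y : h y = (w * (g^-1 * f y))%g by rewrite /g invgM /h mulgA mulVKg.
  pose a i := sval (cid (cob g i)).
  have cobi i : exists c, forall y, far D (y - c) -> over g (a i) y.
    exact: (svalP (cid (cob g i))).
  have [c' c'E] := choice cobi.
  have [N NE] : exists N, forall M i, (N <= M)%N -> far D (axis n M%:Z - c' i).
    have [N NE] := choice (fun i => far_pt D (c' i)).
    exists (\max_i N i)%N => M i NM; apply: NE; apply: leq_trans NM.
    exact: (@leq_bigmax _ N i).
  have [i ai] : exists i, a i != 0.
    apply: contrapT => na.
    have az i : a i = 0 by apply: contrapT => /eqP ai; apply: na; exists i.
    have fg M : (N <= M)%N -> f (axis n M%:Z) = g.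
      move=> NM; apply: (@mulgI _ g^-1%g); rewrite mulVg.
      apply: val_inj; case E: (val _) => [|[i b] s] //.
      have := c'E i _ (NE M i NM); rewrite /over E az head_syl_cons => b0.
      have := valP (g^-1 * f (axis n M%:Z))%g; rewrite E -/(syl b) reduced_cons.
      by rewrite b0 eqxx.
    have [r rE] := fp [:: 1%g].
    have := rE (axis n N%:Z) (axis n (N + r.+1)%N%:Z).
    rewrite !fg ?leq_addr // mulVg inE => /(_ (eqxx _)) /nearP /(_ (Ordinal n0)).
    by rewrite !mxE /=; lia.
  (* a point in both sets: its word shows that w can be extended by a i *)
  have [N1 N1E] := far_pt D c.
  pose y1 := axis n (maxn N N1)%:Z.
  have /prefixP[v vE] : behind w y1 by apply/cE/N1E/leq_maxr.
  have red : reduced (val w ++ v) by rewrite -vE; apply: valP.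
  pose V : freeprod A := exist (fun s => is_true (reduced s)) v (reduced_catr red).
  have VE : V = (g^-1 * f y1)%g.
    apply: (@mulgI _ w); rewrite -hw; apply: val_inj.
    by rewrite vE; apply: val_mulg_cat.
  have hdv : head_syl i v = a i.
    by have := c'E i _ (NE _ i (leq_maxl N N1)); rewrite /over -VE.
  have consE s : reduced s -> head_syl i s = a i -> exists t, s = syl (a i) :: t.
    move=> rs hs; exists (tail_syl i s); rewrite -{1}(cons_head_tail i rs) hs.
    by rewrite /cons_syl (negPf ai).
  have [t tE] := consE _ (reduced_catr red) hdv.
  have redw : reduced (rcons (val w) (syl (a i))).
    by apply: (@reduced_catl _ _ _ t); rewrite cat_rcons -tE.
  exists (exist (fun s => is_true (reduced s)) _ redw); rewrite size_rcons; split=> //.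
  exists (c' i) => y /c'E oy; rewrite /behind /= hw.
  have [t' t'E] := consE _ (valP (g^-1 * f y)%g) oy.
  rewrite (val_mulg_cat (erefl _) t'E) -?cat_rcons ?prefix_prefix //.
  rewrite cat_rcons; apply: reduced_glue => //.
  by rewrite -t'E; apply: valP.
have all_N N : exists w : freeprod A, size (val w) = N /\
    exists c, forall y, far D (y - c) -> behind w y.
  elim: N => [|N [w [<- /step//]]].
  by exists 1%g; split=> //; exists 0 => y _; apply: prefix0s.
pose y1 := axis n (D + D).+1%:Z.
have [w [wN [c cE]]] := all_N (size (val (h y1))).+1.
have near0 : near D (0 - c).
  apply: contraT => /cE; rewrite /behind /h mulVg.
  by move=> /prefixP[v] /(congr1 size); rewrite size_cat wN.
have : far D (y1 - c).
  apply/farP; exists (Ordinal n0); move/nearP: near0 => /(_ (Ordinal n0)).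
  by rewrite !mxE /=; move: (c _ _) => z; lia.
move/cE; rewrite /behind => /prefixP[v] /(congr1 size); rewrite size_cat wN.
by move/eqP; rewrite addSn -addnS eq_sym -[X in _ == X]addn0 eqn_add2l.
Qed.

(** A one-ended space cannot be cut by the bounded preimage of a point, so for
    each coset either one fibre of the projection is almost everything, or all
    fibres are bounded; the first cannot happen for all cosets. *)
Lemma lattice_near_coset : exists i (g : freeprod A) (F : seq (freeprod A)),
  forall y, exists a : A i, ((finj a)^-1 * (g^-1 * f y))%g \in F.
Proof.
have [D DE] := over_dichotomy.
case: (pselect (exists g i, forall a : A i, exists c, forall y,
    far D (y - c) -> ~ over g a y)) => [[g [i bnd]]|nb].
  by exists i, g; apply: near_coset bnd.
case: (@no_escape D) => g i; apply: contrapT => na; apply: nb; exists g, i => a.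
have [c [ca|cb]] := DE g i a; last by exists c.
by case: na; exists a, c.
Qed.

End LatticeInFreeProduct.

(** * Quasi-isometries as coarse equivalences *)

Definition coarse_pair (G1 G2 : groupType) (f : G1 -> G2) (h : G2 -> G1) :=
  [/\ bornologous f, bornologous h,
      exists F : seq G1, forall x, (x^-1 * h (f x))%g \in F &
      exists F : seq G2, forall z, (z^-1 * f (h z))%g \in F].

Lemma coarse_pair_sym (G1 G2 : groupType) (f : G1 -> G2) h :
  coarse_pair f h -> coarse_pair h f.
Proof. by case. Qed.

(** Word lengths are natural numbers, so the real constants can be rounded up. *)
Lemma quasi_isometric_nat (R : realType) (G1 G2 : groupType) :
  quasi_isometric R G1 G2 ->
  exists (X1 : seq G1) (X2 : seq G2) (f : G1 -> G2) (k c : nat),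
    [/\ generates X1, generates X2,
      forall x y, (word_length X2 ((f x)^-1 * f y)%g <=
        k * word_length X1 (x^-1 * y)%g + c)%N /\
        (word_length X1 (x^-1 * y)%g <= k * (word_length X2 ((f x)^-1 * f y)%g + c))%N &
      forall z, exists x, (word_length X2 ((f x)^-1 * z)%g <= c)%N].
Proof.
move=> [X1 [X2 [gX1 gX2 [f [K [C [K1 C0 KC Cz]]]]]]].
have K0 : 0 < K := lt_le_trans ltr01 K1.
pose k := Num.bound K; pose c := Num.bound C.
have Kk : K <= k%:R by apply/ltW/archi_boundP/ltW.
have Cc : C <= c%:R by apply/ltW/archi_boundP.
exists X1, X2, f, k, c; split=> // [x y|z]; last first.
  have [x] := Cz z; exists x; rewrite -(ler_nat R).
  exact: le_trans Cc.
have := KC x y; rewrite /word_dist; set d1 := word_length X1 _; set d2 := word_length X2 _.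
case/andP=> lo up; split; rewrite -(ler_nat R).
  rewrite natrD natrM; apply: le_trans up _; apply: lerD => //.
  by apply: ler_wpM2r.
rewrite natrM natrD; apply: le_trans (_ : K * (d2%:R + C) <= _).
  by rewrite -ler_pdivrMl // -lerBlDr.
apply: ler_pM => //; first exact: ltW.
  by apply: addr_ge0.
exact: lerD.
Qed.

Lemma quasi_isometric_coarse (R : realType) (G1 G2 : groupType) :
  quasi_isometric R G1 G2 -> exists (f : G1 -> G2) h, coarse_pair f h.
Proof.
move=> /quasi_isometric_nat[X1 [X2 [f [k [c [gX1 gX2 fE lattice_prod]]]]]].
have [h hE] := choice lattice_prod; exists f, h.
have hV z : (word_length X2 (z^-1 * f (h z))%g <= c)%N.
  by rewrite -[(z^-1 * _)%g]invgK invgM invgK; apply: leq_trans (word_lengthV gX2 _) _.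
split.
- move=> F; have [N NE] := word_length_bounded X1 F.
  have [F' F'E] := word_ball_finite gX2 (k * N + c)%N; exists F' => x y /NE xy.
  apply: F'E; apply: leq_trans (proj1 (fE x y)) _.
  by rewrite leq_add2r leq_mul2l xy orbT.
- move=> F; have [N NE] := word_length_bounded X2 F.
  have [F' F'E] := word_ball_finite gX1 (k * (c + N + c + c))%N; exists F' => z w /NE zw.
  apply: F'E; apply: leq_trans (proj2 (fE _ _)) _; rewrite leq_mul2l leq_add2r.
  apply/orP; right.
  have -> : ((f (h z))^-1 * f (h w) = (f (h z))^-1 * z * (z^-1 * w) * (w^-1 * f (h w)))%g.
    by rewrite !mulgA !mulgK.
  apply: leq_trans (word_lengthM gX2 _ _) _; apply: leq_add => //.
  by apply: leq_trans (word_lengthM gX2 _ _) _; apply: leq_add.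
- have [F FE] := word_ball_finite gX1 (k * (c + c))%N; exists F => x; apply: FE.
  by apply: leq_trans (proj2 (fE _ _)) _; rewrite leq_mul2l leq_add2r hV orbT.
- by have [F FE] := word_ball_finite gX2 c; exists F => z; apply: FE.
Qed.

Lemma bornologous_hom (G1 G2 : groupType) (f : G1 -> G2) :
  {morph f : x y / (x * y)%g} -> bornologous f.
Proof.
move=> fM F; exists [seq f x | x <- F] => x y xy.
by rewrite -(ghomV fM) -fM map_f.
Qed.

Lemma bornologous_comp (G1 G2 G3 : groupType) (f : G1 -> G2) (g : G2 -> G3) :
  bornologous f -> bornologous g -> bornologous (g \o f).
Proof.
by move=> fb gb F; have [F' FE] := fb F; have [F2 F2E] := gb F'; exists F2 => x y /FE/F2E.
Qed.

Lemma coarse_pair_isom (G1 G2 H1 H2 : groupType) (f : G1 -> G2) h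
    (p1 : G1 -> H1) (q1 : H1 -> G1) (p2 : G2 -> H2) (q2 : H2 -> G2) :
    gisom p1 q1 -> gisom p2 q2 -> coarse_pair f h ->
  coarse_pair (p2 \o f \o q1) (p1 \o h \o q2).
Proof.
move=> [p1M q1M pq1 qp1] [p2M q2M pq2 qp2] [fb hb [F FE] [F' F'E]]; split.
- by do 2?apply: bornologous_comp => //; apply: bornologous_hom.
- by do 2?apply: bornologous_comp => //; apply: bornologous_hom.
- exists [seq p1 x | x <- F] => x /=; rewrite pq2.
  by rewrite -[X in (X^-1 * _)%g]qp1 -(ghomV p1M) -p1M map_f.
- exists [seq p2 x | x <- F'] => x /=; rewrite pq1.
  by rewrite -[X in (X^-1 * _)%g]qp2 -(ghomV p2M) -p2M map_f.
Qed.

(** * Lattices in groups *)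

Section LatticeHom.
Variables (n : nat) (G : groupType) (e : 'rV[int]_n -> G).
Hypothesis eD : {morph e : a b / (a + b)%R >-> (a * b)%g}.

Lemma lattice_hom_bornologous : lattice_bornologous e.
Proof.
move=> r; have [s sE] := near_finite n r; exists [seq e v | v <- s] => y z yz.
by rewrite -(zhomN eD) -eD addrC map_f // sE.
Qed.

Lemma lattice_hom_proper : injective e -> lattice_proper e.
Proof.
move=> eI F.
have ex t : exists v, forall u, e u = t -> v = u.
  case: (pselect (exists v, e v = t)) => [[v <-]|nv]; first by exists v => u /eI.
  by exists 0 => u ut; case: nv; exists u.
have [v vE] := choice ex; have [r rE] := near_bounded [seq v t | t <- F].
exists r => y z; rewrite -(zhomN eD) -eD addrC => tF.
by apply: rE; apply/mapP; exists (e (z - y)%R) => //; rewrite (vE _ _ (erefl _)).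
Qed.

End LatticeHom.

Section LatticeCoarse.
Variables (n : nat) (G1 G2 : groupType) (e : 'rV[int]_n -> G1).
Variables (f : G1 -> G2) (h : G2 -> G1).

Lemma lattice_bornologous_comp :
  lattice_bornologous e -> bornologous f -> lattice_bornologous (f \o e).
Proof.
by move=> eb fb r; have [F FE] := eb r; have [F' F'E] := fb F;
  exists F' => y z /FE/F'E.
Qed.

Lemma lattice_proper_comp :
  lattice_proper e -> coarse_pair f h -> lattice_proper (f \o e).
Proof.
move=> ep [fb hb [F FE] _] F'; have [S SE] := hb F'.
have [r rE] := ep [seq (a * b)%g | a <- F, b <- [seq (s * a^-1)%g | s <- S, a <- F]].
exists r => y z /SE /= yz; apply: rE; apply/allpairsP.
exists ((e y)^-1 * h (f (e y)),
  (h (f (e y)))^-1 * h (f (e z)) * ((e z)^-1 * h (f (e z)))^-1)%g.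
split=> //=; last by rewrite invgM invgK !mulgA mulgK mulgK.
by apply/allpairsP; exists ((h (f (e y)))^-1 * h (f (e z)), (e z)^-1 * h (f (e z)))%g; split=> /=.
Qed.

End LatticeCoarse.

Lemma finj_inj (I : finType) (A : I -> zmodType) i : injective (@finj I A i).
Proof.
move=> a b /(congr1 (fun w => head_syl i (val w))).
by rewrite !val_finj !head_syl_cons_syl.
Qed.

(** Moving each [e y] to a close point [g * finj (a y)] gives a Lipschitz map
    [a] to [A i] with bounded fibres, to which growth applies. *)
Lemma lattice_near_rank (I : finType) (A : I -> zmodType) (n m : nat)
    (e : 'rV[int]_n -> freeprod A) (i : I) (g : freeprod A) (F : seq (freeprod A)) :
    lattice_bornologous e -> lattice_proper e ->
    (forall y, exists a : A i, ((finj a)^-1 * (g^-1 * e y))%g \in F) ->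
    has_rank (A i) m ->
  (n <= m)%N.
Proof.
move=> eb ep ex [T [p [q pK qK]]].
have [a aE] := choice ex.
pose t y := ((finj (a y))^-1 * (g^-1 * e y))%g.
have finja y : finj (a y) = (g^-1 * e y * (t y)^-1)%g.
  by rewrite /t !invgM !invgK !mulgA mulgK mulVg mul1g.
have diff y z : finj (a z - a y) = (t y * ((e y)^-1 * e z) * (t z)^-1)%g.
  rewrite addrC (finjD) (zhomN (@finjD _ A i)) !finja.
  move: (t y) (t z) => ty tz.
  by rewrite !invgM !invgK !mulgA mulgK.
have [S SE] := eb 1%N.
pose W := [seq (b * s^-1)%g | b <- [seq (c * d)%g | c <- F, d <- S], s <- F].
have WE y l : finj (a (y + unit l) - a y) \in W.
  rewrite diff; apply/allpairsP.
  exists (t y * ((e y)^-1 * e (y + unit l)), t (y + unit l))%g; split=> //=.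
    apply/allpairsP; exists (t y, (e y)^-1 * e (y + unit l))%g; split=> //=.
      exact: aE.
    by apply: SE; rewrite addrC addKr near_unit.
  exact: aE.
have exV w : exists v : 'rV[int]_m, forall b : A i, finj b = w -> v = (p b).1.
  case: (pselect (exists b : A i, finj b = w)) => [[b <-]|nb].
    by exists (p b).1 => b' /finj_inj ->.
  by exists 0 => b bw; case: nb; exists b.
have [v vE] := choice exV.
have [L LE] := near_bounded [seq v w | w <- W].
have [r rE] := ep [seq (b^-1 * c)%g | b <- F, c <- F].
apply: (@lattice_growth n m T (fun y => p (a y)) L r).
  move=> y l; have -> : (p (a (y + unit l))).1 - (p (a y)).1 = (p (a (y + unit l) - a y)).1.
    by rewrite raddfB.
  apply: LE; apply/mapP; exists (finj (a (y + unit l) - a y)); first exact: WE.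
  by rewrite (vE _ _ (erefl _)).
move=> y y' /(can_inj pK) ayy'; rewrite -nearN opprB; apply: rE.
apply/allpairsP; exists (t y, t y'); split; rewrite /= ?aE //.
by rewrite /t ayy' !invgM !invgK !mulgA mulgK mulgK.
Qed.

(** * Quasi-isometric groups have the same ranks *)

(** Two distinct factors have no infinite part in common, even up to
    conjugation and bounded distance: retract onto one of them. *)
Lemma lattice_same_factor (I : finType) (A : I -> zmodType) (n : nat) (i k : I)
    (e : 'rV[int]_n -> A i) (g : freeprod A) (F : seq (freeprod A)) :
    (0 < n)%N -> injective e ->
    (forall y, exists a : A k, ((finj a)^-1 * (g^-1 * finj (e y)))%g \in F) ->
  k = i.
Proof.
move=> n0 eI ex; have [a aE] := choice ex; apply/eqP; apply: contraT => ki.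
pose t y := ((finj (a y))^-1 * (g^-1 * finj (e y)))%g.
(* pigeonhole on the finite set F *)
have [y [z [yz tyz]]] : exists y z, y != z /\ t y = t z.
  pose pt (j : 'I_(size F).+1) : 'rV[int]_n := axis n (j : nat)%:Z.
  have ptI : injective pt.
    move=> j j' /rowP/(_ (Ordinal n0)); rewrite !mxE /= => -[jj'].
    exact: val_inj.
  have : ~~ injectiveb (fun j => t (pt j)).
    apply/negP => /injectiveP inj; have := @uniq_leq_size _ (codom (fun j => t (pt j))) F.
    rewrite size_codom card_ord ltnn; case/(_ _ _)/notF.
      by rewrite /codom map_inj_uniq ?enum_uniq.
    by move=> w /codomP[j ->]; apply: aE.
  move=> /injectivePn[j [j' jj' E]]; exists (pt j), (pt j'); split=> //.
  by apply: contraNneq jj' => /ptI ->.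
have fD j : {morph (fun b : A j => if j == i then finj b else 1%g : freeprod A)
    : a b / (a + b)%R >-> (a * b)%g}.
  by move=> b c; case: ifP; rewrite ?mulg1 // finjD.
have [pr prM prE] := free_homE (freeprod_free A) fD.
have tE x : pr (t x) = (pr g^-1%g * finj (e x))%g.
  by rewrite /t prM (ghomV prM) prE (negPf ki) invg1 mul1g prM prE eqxx.
have := congr1 pr tyz; rewrite !tE => /mulgI /finj_inj /eI /eqP.
by rewrite (negPf yz).
Qed.

Lemma rank_data (V : zmodType) n : has_rank V n ->
  exists (T : finZmodType) (g : 'rV[int]_n * T -> V),
    [/\ {morph g : a b / a + b}, injective g & forall x, exists z, g z = x].
Proof.
case=> T [f [g fK gK]]; exists T, g; split.
- by move=> a b; apply: (can_inj fK); rewrite raddfD !gK.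
- exact: can_inj gK.
- by move=> x; exists (f x).
Qed.

(** The image of the lattice gives [n <= m], and its way back [m <= n]. *)
Lemma coarse_ranks (I1 I2 : finType) (A1 : I1 -> zmodType) (A2 : I2 -> zmodType)
    (f : freeprod A1 -> freeprod A2) h n :
    (forall j, fg_abelian (A2 j)) -> coarse_pair f h -> (2 <= n)%N ->
    (exists i, has_rank (A1 i) n) ->
  exists j, has_rank (A2 j) n.
Proof.
move=> fg2 fh n2 [i rin].
have [fb hb [Fx FxE] _] := fh.
have [T [g [gD gI gS]]] := rank_data rin.
pose e0 (y : 'rV[int]_n) := g (y, 0).
have e0D : {morph e0 : a b / a + b}.
  by move=> a b; rewrite /e0 -gD; congr g; congr (_, _); rewrite addr0.
have e0I : injective e0 by move=> a b /gI[].
pose e y : freeprod A1 := finj (e0 y).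
have eD : {morph e : a b / (a + b)%R >-> (a * b)%g}.
  by move=> a b; rewrite /e e0D finjD.
have eI : injective e by move=> a b /finj_inj/e0I.
have eb := lattice_hom_bornologous eD; have ep := lattice_hom_proper eD eI.
have feb := lattice_bornologous_comp eb fb; have fep := lattice_proper_comp ep fh.
have [j [u [F FE]]] := lattice_near_coset n2 feb fep.
have [m rjm] := fg_abelian_rank (fg2 j).
have nm := lattice_near_rank feb fep FE rjm.
(* back: the free part of A2 j, translated by u, goes to a coset in G1 *)
have [S [q [qD qI qS]]] := rank_data rjm.
pose d0 (x : 'rV[int]_m) : freeprod A2 := finj (q (x, 0)).
have d0D : {morph d0 : a b / (a + b)%R >-> (a * b)%g}.
  move=> a b; rewrite /d0 -finjD -qD; congr (finj (q _)); congr (_, _).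
  by rewrite addr0.
have d0I : injective d0 by move=> a b /finj_inj/qI[].
pose d x := (u * d0 x)%g.
have dE y z : ((d y)^-1 * d z = (d0 y)^-1 * d0 z)%g by rewrite invgM mulgA mulgVK.
have db : lattice_bornologous d.
  move=> r; have [F0 F0E] := lattice_hom_bornologous d0D r.
  by exists F0 => y z; rewrite dE; apply: F0E.
have dp : lattice_proper d.
  move=> F0; have [r rE] := lattice_hom_proper d0D d0I F0.
  by exists r => y z; rewrite dE; apply: rE.
have hdb := lattice_bornologous_comp db hb.
have hdp := lattice_proper_comp dp (coarse_pair_sym fh).
have [k [u' [F' F'E]]] := lattice_near_coset (leq_trans n2 nm) hdb hdp.
(* f (e y) is close to the free part of u A_j, so e y is close to u' A_k *)
have close y : exists w s, exists2 t, t \in F &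
    ((d w)^-1 * f (e y))%g = (finj (q (0, s)) * t)%g.
  have [b bF] := FE y; have [[w s] bE] := qS b; exists w, s.
  exists ((finj b)^-1 * (u^-1 * f (e y)))%g => //.
  have -> : b = q (w, 0) + q (0, s).
    by rewrite -bE -qD; congr q; congr (_, _); rewrite /= ?addr0 ?add0r.
  by rewrite finjD /d /d0 !invgM !mulgA mulgV mul1g.
have [F6 F6E] := hb [seq (finj (q (0%R, s)) * t)%g | s <- enum S, t <- F].
have ki : k = i.
  apply: (@lattice_same_factor I1 A1 n i k e0 u'
    [seq (b * c^-1)%g | b <- [seq (a * b)%g | a <- F', b <- F6], c <- Fx]) => //.
    exact: ltnW.
  move=> y; have [w [s [t tF wE]]] := close y; have [a aF] := F'E w; exists a.
  rewrite -/(e y); apply/allpairsP.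
  exists ((finj a)^-1 * (u'^-1 * h (d w)) * ((h (d w))^-1 * h (f (e y))),
          (e y)^-1 * h (f (e y)))%g; split=> //=.
    apply/allpairsP.
    exists ((finj a)^-1 * (u'^-1 * h (d w)), (h (d w))^-1 * h (f (e y)))%g; split=> //=.
    apply: F6E; rewrite wE; apply/allpairsP; exists (s, t); split=> //=.
    by rewrite mem_enum.
  by rewrite invgM invgK !mulgA !mulgK.
subst k; have mn := lattice_near_rank hdb hdp F'E rin.
by exists j; rewrite (_ : n = m) //; apply/eqP; rewrite eqn_leq nm.
Qed.

(** * The classification *)

Lemma ranks_choice (I : finType) (A : I -> zmodType) :
  (forall i, fg_abelian (A i)) -> exists n : I -> nat, forall i, has_rank (A i) (n i).
Proof.
move=> fgA; have [n nE] := choice (fun i => fg_abelian_rank (fgA i)).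
by exists n.
Qed.

Lemma ranks_commensurable (I1 I2 : finType) (A1 : I1 -> zmodType)
    (A2 : I2 -> zmodType) :
    (forall i, fg_abelian (A1 i)) -> (forall i, fg_abelian (A2 i)) ->
    nonelementary A1 -> nonelementary A2 -> ranks_ge2 A1 = ranks_ge2 A2 ->
  commensurable (freeprod A1) (freeprod A2).
Proof.
move=> fg1 fg2 nd1 nd2 ranks.
have [n1 n1E] := ranks_choice fg1; have [n2 n2E] := ranks_choice fg2.
have [L1 [c1 s1 p1 L1E]] := commensurable_ranks nd1 n1E.
have [L2 [c2 s2 p2 L2E]] := commensurable_ranks nd2 n2E.
have rankE I (A : I -> zmodType) (n : I -> nat) s : (forall i, has_rank (A i) (n i)) ->
    (2 <= s)%N -> (exists i, n i = s) <-> ranks_ge2 A s.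
  move=> nE s2'; split=> [[i ns]|[_ [i ri]]]; last first.
    by exists i; apply: rank_unique ri.
  by split=> //; exists i; rewrite -ns.
have L12 s : (2 <= s)%N -> (s \in L1) = (s \in L2).
  move=> s2'; apply/idP/idP => [/(L1E s s2')|/(L2E s s2')].
    by move/(rankE _ _ _ _ n1E s2'); rewrite ranks => /(rankE _ _ _ _ n2E s2')/(L2E s s2').
  by move/(rankE _ _ _ _ n2E s2'); rewrite -ranks => /(rankE _ _ _ _ n1E s2')/(L1E s s2').
apply: commensurable_trans c1 _; apply: commensurable_trans (commensurable_sym c2).
exact: lattice_prod_same_ranks.
Qed.

Theorem theorem1 (R : realType)
    (I1 : finType) (A1 : I1 -> zmodType) (G1 : groupType)
    (iota1 : forall i : I1, A1 i -> G1)
    (I2 : finType) (A2 : I2 -> zmodType) (G2 : groupType)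
    (iota2 : forall i : I2, A2 i -> G2)
    (hA1 : forall i : I1, fg_abelian (A1 i))
    (hA2 : forall i : I2, fg_abelian (A2 i))
    (hG1 : is_free_product iota1)
    (hG2 : is_free_product iota2)
    (hnd1 : nonelementary A1)
    (hnd2 : nonelementary A2) :
  [<-> ranks_ge2 A1 = ranks_ge2 A2;
       commensurable G1 G2;
       quasi_isometric R G1 G2].
Proof.
have [p1 [q1 [iso1 _ _]]] := free_normal_form hG1.
have [p2 [q2 [iso2 _ _]]] := free_normal_form hG2.
tfae.
- move=> ranks; apply: commensurable_trans (gisom_commensurable iso1) _.
  apply: commensurable_trans (commensurable_sym (gisom_commensurable iso2)).
  exact: ranks_commensurable.
- have [X1 gX1] := free_product_fg hA1 hG1; have [X2 gX2] := free_product_fg hA2 hG2.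
  exact: commensurable_quasi_isometric gX1 gX2.
- move=> /quasi_isometric_coarse[f [h fh]].
  have fh' := coarse_pair_isom iso1 iso2 fh.
  apply/seteqP; split=> s [s2 rs]; split=> //.
    exact: coarse_ranks hA2 fh' s2 rs.
  exact: coarse_ranks hA1 (coarse_pair_sym fh') s2 rs.
Qed.
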